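(* Let $n\ge 1$ be an integer and let $\Delta_n$ be the $h$-complex of the truncated Boolean algebra $\hat{B}_n$ with respect to its standard lexicographic shelling. For every integer $i$, the reduced homology group $\tilde{H}_i(\Delta_n,\mathbb{Z})$ is nonzero if and only if $$\frac{3i+5}{2}\le n\le 3i+4.$$
   Context: For an integer $n\ge 1$ let $B_n$ be the poset of all subsets of $[n]=\{1,\dots,n\}$ ordered by inclusion, and let $\hat{B}_n=B_n\setminus\{\emptyset,[n]\}$. The order complex $\Delta(\hat{B}_n)$ is the simplicial complex whose faces are the chains of $\hat{B}_n$. Its facets correspond to permutations $\pi=\pi_1\cdots\pi_n\in S_n$ (the order in which elements are inserted in a saturated chain of $B_n$), and ordering the facets lexicographically by these permutations is a shelling (the standard shelling). The minimal new face contributed by $\pi$ is the chain supported at the descents of $\pi$, $$\sigma_\pi=\{\{\pi_1,\dots,\pi_i\} : 1\le i\le n-1,\ \pi_i>\pi_{i+1}\}.$$ The collection $\Delta_n=\{\sigma_\pi : \pi\in S_n\}$ is a subcomplex of $\Delta(\hat{B}_n)$, called the $h$-complex of $\hat{B}_n$ with respect to the standard shelling. The identity permutation gives the empty face, of dimension $-1$; in general $\dim\sigma_\pi$ is the number of descents of $\pi$ minus $1$. Reduced homology is computed with the augmented chain complex, so $\tilde H_{-1}(\{\emptyset\},\mathbb{Z})=\mathbb{Z}$. *)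

(* Defs.v *)
From HB Require Import structures.
From mathcomp Require Import all_boot all_order all_fingroup all_algebra.
From mathcomp Require Import boolp.

Set Implicit Arguments.
Unset Strict Implicit.
Unset Printing Implicit Defensive.

Import Order.TTheory GRing.Theory Num.Theory.

Local Open Scope ring_scope.

(** * Reduced simplicial homology over Z

    A finite simplicial complex on the finite vertex type [V] is given by its
    set of faces [K : {set {set V}}], the empty face included; [K] is meant to
    be closed under taking subsets. *)

Section ReducedHomology.
Variables (V : finType) (K : {set {set V}}).

(* The faces of dimension i, i.e. with i + 1 vertices; the empty face is the
   only one of dimension -1. *)
Definition face (i : int) : predArgType :=
  {F : {set V} | (F \in K) && (#|F|%:Z == i + 1)}.

Definition chain (i : int) : predArgType := {ffun face i -> int}.

(* Every face is oriented by the order in which [enum V] lists its vertices: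
   if F = {v_0, ..., v_d} in that order, then [vertex_pos F v_k = k], and the
   coefficient of G in the boundary of F is (-1)^k if G = F \ {v_k}, and 0 if
   G is not of this form. *)
Definition vertex_pos (F : {set V}) (v : V) : nat :=
  #|[set w in F | (enum_rank w < enum_rank v)%N]|.

Definition incidence (F G : {set V}) : int :=
  \sum_(v in F | F :\ v == G) (-1) ^+ vertex_pos F v.

(* The boundary operator is [bd i (i - 1)].  The target degree is a separate
   argument so that [bd (i + 1) i] has type [chain (i + 1) -> chain i], the
   integer [i + 1 - 1] not being convertible to [i]. *)
Definition bd (i j : int) (c : chain i) : chain j :=
  [ffun G : face j => \sum_(F : face i) incidence (val F) (val G) * c F].

Lemma bd_is_zmod_morphism (i j : int) : zmod_morphism (@bd i j).
Proof.
move=> c c'; apply/ffunP => G; rewrite !ffunE -sumrB.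
by apply: eq_bigr => F _; rewrite !ffunE mulrBr.
Qed.

HB.instance Definition _ (i j : int) :=
  GRing.isZmodMorphism.Build (chain i) (chain j) (@bd i j)
    (@bd_is_zmod_morphism i j).

Definition is_cycle (i : int) : {pred chain i} :=
  fun c => @bd i (i - 1) c == 0.

Lemma is_cycle_zmod_closed (i : int) : zmod_closed (@is_cycle i).
Proof.
split=> [|c c']; first by rewrite unfold_in /is_cycle raddf0.
rewrite !unfold_in /is_cycle => /eqP hc /eqP hc'.
by rewrite raddfB /= hc hc' subrr.
Qed.

HB.instance Definition _ (i : int) :=
  GRing.isZmodClosed.Build (chain i) (@is_cycle i) (@is_cycle_zmod_closed i).

Record cycles (i : int) := Cycle {
  chain_of_cycle :> chain i;
  _ : chain_of_cycle \in @is_cycle i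
}.

HB.instance Definition _ (i : int) := [isSub for @chain_of_cycle i].
HB.instance Definition _ (i : int) := [Choice of cycles i by <:].
HB.instance Definition _ (i : int) :=
  [SubChoice_isSubZmodule of cycles i by <:].

Definition is_boundary (i : int) : {pred cycles i} :=
  fun z => `[< exists b : chain (i + 1), @bd (i + 1) i b = val z >].

Lemma is_boundary_zmod_closed (i : int) : zmod_closed (@is_boundary i).
Proof.
split=> [|z z'].
  by apply/asboolP; exists 0; rewrite !raddf0.
move=> /asboolP[b hb] /asboolP[b' hb']; apply/asboolP.
by exists (b - b'); rewrite !raddfB /= hb hb'.
Qed.

HB.instance Definition _ (i : int) :=
  GRing.isZmodClosed.Build (cycles i) (@is_boundary i)
    (@is_boundary_zmod_closed i).

Definition reduced_homology (i : int) : zmodType :=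
  Quotient.quot (@is_boundary i).

End ReducedHomology.

(** * The h-complex of the truncated Boolean algebra

    The ground set {1, ..., n} is represented by ['I_n] = {0, ..., n - 1}, and a
    permutation [s : 'S_n] by the word s 0, s 1, ..., s (n - 1).  Vertices of
    the order complex are elements of the poset, i.e. sets of type
    [{set 'I_n}], and faces are sets of vertices. *)

(* 0-based position [i] is a descent: i + 1 < n and s i > s (i + 1). *)
Definition descent (n : nat) (s : 'S_n) (i : 'I_n) : bool :=
  [exists j : 'I_n, (val j == i.+1) && (s j < s i)%N].

(* The set of the first i + 1 letters of s. *)
Definition prefix_set (n : nat) (s : 'S_n) (i : 'I_n) : {set 'I_n} :=
  [set s k | k : 'I_n & (k <= i)%N].

(* The minimal new face contributed by the facet s in the lexicographic
   shelling. *)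
Definition new_face (n : nat) (s : 'S_n) : {set {set 'I_n}} :=
  [set prefix_set s i | i : 'I_n & descent s i].

Definition h_complex (n : nat) : {set {set {set 'I_n}}} :=
  [set new_face s | s : 'S_n].

(* Main.v *)
Require Import Defs.
From mathcomp Require Import all_boot all_order all_fingroup all_algebra.
From mathcomp Require Import boolp zify ring.

Set Implicit Arguments.
Unset Strict Implicit.
Unset Printing Implicit Defensive.

Import Order.TTheory GRing.Theory Num.Theory.
Local Open Scope ring_scope.

(** Faces of the complex are chains of sets, or equivalently ordered set
    partitions S_0 | S_1 | ... | S_d of the letters in which every bar is a
    descent: max S_j > min S_(j+1) ([mem_h_complex]).  With s letters and d
    bars, the claim is that homology lives exactly where s <= 3d + 1 and
    3d + 2 <= 2s ([homology_range]).

    Vanishing.  There is an acyclic matching all of whose critical faces have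
    a number of bars in the range ([morse_descent_chain]), and a matching
    without critical d-faces kills homology ([morse_exact]).  It is built by
    induction on s from the two largest letters m > p.  Faces are sorted by
    where m and p sit.  Faces m|p|T are matched with mp|T, and faces T m|p with
    T p m (merging the two last blocks).  In every other position, the letters
    m and p cut the face into at most two smaller faces of the same kind, chosen
    independently, and these are matched by induction:
    - U m | V, with p in U or in V (and U, V not reduced to p),
    - m | U p | V, where V may be empty,
    - U p | V m, where U may be empty.
    Here X m stands for the partition X with m added to its last block.
    The bounds on the number of bars add up in each of the three cases.
    Removing only the largest letter does not suffice: for s = 3k + 2 the pieces
    m|T and T m on their own have critical faces just outside the range, and
    matching these requires the faces mp|T' and T' m|p of other pieces.

    Nonvanishing.  A cycle that does not vanish at some facet F of the complex is
    not a boundary, since no face contains F strictly ([facet_detects]).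
    Such a pair is built by induction on s, adding letters at the end of the
    partition; in terms of chains of sets, the cycle is joined with the boundary
    of a simplex, two new vertices or a triangle:
    - one new smallest and one new largest letter, one bar ([detected_outer]),
    - three new largest letters, one bar ([detected_upper]),
    - three new smallest letters, two bars ([detected_lower]).
    Starting from one letter, these steps reach the whole range. *)

(** * Chains on the full simplex, and homology *)

Lemma homology_neq0P (V : finType) (K : {set {set V}}) (i : int) :
  (exists h : reduced_homology K i, h != 0) <->
  exists c : chain K i, @bd V K i (i - 1) c = 0 /\
    ~ exists b : chain K (i + 1), @bd V K (i + 1) i b = c.
Proof.
have pi0 : \pi_(reduced_homology K i)%qT (0 : cycles K i) = 0.
  by rewrite ring_quotient.pi_zeror.
split=> [[h h0]|[c [zc nbc]]].
  exists (val (generic_quotient.repr h)); split.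
    by have := valP (generic_quotient.repr h); rewrite unfold_in => /eqP.
  move=> [b hb]; move/negP: h0; apply.
  have /asboolP hI : exists b : chain K (i + 1), @bd V K (i + 1) i b = val (generic_quotient.repr h).
    by exists b.
  have : (generic_quotient.repr h - 0) \in @is_boundary V K i by rewrite subr0; exact: hI.
  rewrite Quotient.idealrBE generic_quotient.reprK => /eqP ->; apply/eqP.
  exact: pi0.
have hz : c \in @is_cycle V K i by rewrite unfold_in; apply/eqP.
exists (\pi_(reduced_homology K i) (Cycle hz))%qT.
apply/eqP => e0.
have : (Cycle hz - 0) \in @is_boundary V K i.
  rewrite Quotient.idealrBE; apply/eqP; rewrite e0.
  exact: esym pi0.
by rewrite subr0 => /asboolP /nbc.
Qed.

Lemma incidence_neq0 (V : finType) (F G : {set V}) :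
  incidence F G != 0 -> G \subset F /\ #|F| = #|G|.+1.
Proof.
move=> h; case: (pickP [pred v in F | F :\ v == G]) => [v /= /andP[vF /eqP <-]|none].
  by rewrite subD1set [#|F|](cardsD1 v) vF.
by move: h; rewrite /incidence big_pred0 ?eqxx.
Qed.

Lemma incidenceD1 (V : finType) (F : {set V}) (v : V) :
  v \in F -> incidence F (F :\ v) = (-1) ^+ vertex_pos F v.
Proof.
move=> vF; rewrite /incidence (bigD1 v) ?vF ?eqxx //= big1 ?addr0 //.
move=> w /andP[/andP[wF /eqP e] wv].
have : w \notin F :\ v by rewrite -e !inE eqxx.
by rewrite !inE wv wF.
Qed.

Lemma incidence_sq (V : finType) (F G : {set V}) :
  G \subset F -> #|F| = #|G|.+1 -> incidence F G * incidence F G = 1.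
Proof.
move=> GF cF.
have /cards1P[v ev] : #|F :\: G| == 1%N by rewrite cardsD (setIidPr GF) cF subSnn.
have vF : v \in F by have := set11 v; rewrite -ev inE => /andP[].
have -> : G = F :\ v by rewrite -ev setDDr setDv set0U (setIidPr GF).
by rewrite incidenceD1 // -expr2 sqrr_sign.
Qed.


(** The simplicial boundary on chains of the full simplex on [V], a chain being
    given by its coefficients on all subsets of [V]. *)
Definition full_bd (V : finType) (f : {set V} -> int) (G : {set V}) : int :=
  \sum_(v | v \notin G) (-1) ^+ vertex_pos (v |: G) v * f (v |: G).

(** The sign rule behind all boundary computations: inserting two vertices in
    either order gives opposite signs, because exactly one of the two
    precedes the other. *)
Lemma vertex_pos_swap (V : finType) (G : {set V}) (v w : V) :
  v != w -> v \notin G -> w \notin G ->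
  (-1) ^+ vertex_pos (w |: (v |: G)) w * (-1) ^+ vertex_pos (v |: G) v =
  - ((-1) ^+ vertex_pos (v |: (w |: G)) v * (-1) ^+ vertex_pos (w |: G) w) :> int.
Proof.
move=> vw vG wG.
have pos x y : x != y -> x \notin G -> y \notin G ->
    vertex_pos (x |: (y |: G)) x =
    ((enum_rank y < enum_rank x) + vertex_pos (x |: G) x)%N.
  move=> xy xG yG; rewrite /vertex_pos; case: ltnP => lt.
    have -> : [set z in x |: (y |: G) | (enum_rank z < enum_rank x)%N] =
        y |: [set z in x |: G | (enum_rank z < enum_rank x)%N].
      apply/setP=> z; rewrite !inE; case: (eqVneq z y) => [->|] //=.
      by rewrite lt orbT.
    by rewrite cardsU1 !inE negb_and (negPf yG) [y == x]eq_sym (negPf xy).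
  congr #|pred_of_set _|; apply/setP=> z; rewrite !inE.
  by case: (eqVneq z y) => [->|] //=; rewrite ltnNge lt !andbF.
rewrite (pos w v) 1?eq_sym // (pos v w) // !exprD.
have neq : val (enum_rank v) != val (enum_rank w).
  by apply: contra vw => /eqP/val_inj/enum_rank_inj ->.
have -> : (enum_rank w < enum_rank v)%N = ~~ (enum_rank v < enum_rank w)%N.
  by move: neq => /=; case: ltngtP.
rewrite signrN !mulNr opprK -!mulrA; congr (_ * _); exact: mulrC.
Qed.

Lemma full_bdK (V : finType) (f : {set V} -> int) (G : {set V}) :
  full_bd (full_bd f) G = 0.
Proof.
set X := full_bd _ _.
have eX : X = \sum_v \sum_w (if (v != w) && (v \notin G) && (w \notin G) then
    (-1) ^+ vertex_pos (w |: (v |: G)) w * (-1) ^+ vertex_pos (v |: G) v *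
    f (w |: (v |: G)) else 0).
  rewrite /X /full_bd big_mkcond /=; apply: eq_bigr => v _.
  case: ifP => vG; last by rewrite big1 // => w _; rewrite andbF.
  rewrite mulr_sumr big_mkcond; apply: eq_bigr => w _.
  rewrite !inE negb_or eq_sym andbT; case: ifP => // _.
  by rewrite mulrCA mulrA.
suff : X = - X by move=> e; lia.
rewrite {1}eX exchange_big /= eX -sumrN; apply: eq_bigr => v _.
rewrite -sumrN; apply: eq_bigr => w _.
rewrite eq_sym -andbA [(w \notin G) && _]andbC andbA.
case: ifP => [/andP[/andP[vw vG] wG]|_]; last by rewrite oppr0.
by rewrite [in RHS](vertex_pos_swap vw vG wG) mulNr opprK setUCA.
Qed.

Definition extend (V : finType) (K : {set {set V}}) (i : int) (c : chain K i)
  (F : {set V}) : int := oapp c 0 (insub F : option (face K i)).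

Lemma extendE (V : finType) (K : {set {set V}}) (i : int) (c : chain K i)
  (F : face K i) : extend c (val F) = c F.
Proof. by rewrite /extend valK. Qed.

Lemma extend_out (V : finType) (K : {set {set V}}) (i : int) (c : chain K i)
  (F : {set V}) : ~~ ((F \in K) && (#|F|%:Z == i + 1)) -> extend c F = 0.
Proof. by move=> h; rewrite /extend insubN. Qed.

Lemma sum_incidence (V : finType) (f : {set V} -> int) (G : {set V}) :
  \sum_F incidence F G * f F = full_bd f G.
Proof.
rewrite /incidence; under eq_bigr do rewrite mulr_suml big_mkcond /=.
rewrite exchange_big /= /full_bd [RHS]big_mkcond /=; apply: eq_bigr => v _.
case: ifP => vG.
  rewrite (bigD1 (v |: G)) //= setU11 setU1K // eqxx /= big1 ?addr0 // => F nF.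
  case: ifP => // /andP[vF /eqP e]; move: nF.
  by rewrite -e setD1K ?eqxx.
rewrite big1 // => F _; case: ifP => // /andP[vF /eqP e].
by move: vG; rewrite -e !inE eqxx.
Qed.

Lemma bdE (V : finType) (K : {set {set V}}) (i j : int) (c : chain K i) (G : face K j) :
  @bd V K i j c G = full_bd (extend c) (val G).
Proof.
rewrite ffunE -sum_incidence.
rewrite [RHS](bigID [pred F | (F \in K) && (#|F|%:Z == i + 1)]) /=.
rewrite [X in _ = _ + X]big1 ?addr0; last by move=> F /extend_out ->; rewrite mulr0.
rewrite (big_sub [pred F | (F \in K) && (#|F|%:Z == i + 1)]
  (fun F => incidence F (val G) * extend c F)).
by apply: eq_bigr => F _; rewrite extendE.
Qed.

Definition down_closed (V : finType) (K : {set {set V}}) : Prop :=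
  forall F G : {set V}, F \in K -> G \subset F -> G \in K.

Lemma bd_bd (V : finType) (K : {set {set V}}) (i : int) (c : chain K (i + 1)) :
  down_closed K -> @bd V K i (i - 1) (@bd V K (i + 1) i c) = 0.
Proof.
move=> dK; apply/ffunP => G; rewrite bdE [RHS]ffunE -[RHS](full_bdK (extend c) (val G)).
rewrite /full_bd; apply: eq_bigr => v _; congr (_ * _).
case: (boolP ((v |: val G \in K) && (#|v |: val G|%:Z == i + 1))) => h.
  pose F : face K i := Sub (v |: val G) h.
  by rewrite -[v |: val G]/(val F) extendE bdE.
rewrite extend_out // big1 // => w wG.
rewrite extend_out ?mulr0 //; apply: contra h => /andP[hK hc].
rewrite (dK _ _ hK) ?subsetUr //=.
by move: hc; rewrite cardsU1 wG /= => /eqP; lia.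
Qed.

(** * Acyclic matchings *)

(** A matching on the cells satisfying [K], in the sense of discrete Morse
    theory: [mu] adds or removes one vertex, or fixes the cell, which is then
    critical and has a number of vertices in [S].  Acyclicity is expressed by the
    potential [rho], which increases from a cell [G] matched upwards to the other
    faces of [mu G], except those matched downwards.  Asking this also for
    critical faces [G'] is what makes matchings multiply in [morse_product].
    [K] need not be closed under subsets, so that a complex can be cut into
    pieces. *)
Definition morse (V : finType) (K : {set V} -> Prop) (S : nat -> Prop) : Prop :=
  exists (mu : {set V} -> {set V}) (rho : {set V} -> nat),
  [/\ forall F, K F -> K (mu F) /\ mu (mu F) = F,
      forall F, K F -> [\/ mu F = F /\ S #|F|,
         F \subset mu F /\ #|mu F| = #|F|.+1 |
         mu F \subset F /\ #|F| = #|mu F|.+1] &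
      forall G G', K G -> K G' -> #|mu G| = #|G|.+1 -> (#|G'| <= #|mu G'|)%N ->
        #|G'| = #|G| -> G' \subset mu G -> G' != G -> (rho G < rho G')%N].

(** Adding boundaries of the cells [mu G] removes the cells matched upwards from
    the support of a cycle, in order of increasing [rho].  A cycle supported on
    cells matched downwards is zero: take a cell of its support whose partner
    [G] has the least potential; then that cell is the only one of the support
    that contributes to the boundary at [G]. *)
Lemma morse_exact (V : finType) (K : {set {set V}}) (S : nat -> Prop) (i : int)
    (c : chain K i) :
  down_closed K -> morse (fun F => F \in K) S -> (forall d : nat, d%:Z = i + 1 -> ~ S d) ->
  @bd V K i (i - 1) c = 0 -> exists b : chain K (i + 1), @bd V K (i + 1) i b = c.
Proof.
move=> dK [mu [rho [muK mu1 acyc]]] nS zc.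
pose low (G : {set V}) := #|mu G| == #|G|.+1.
have cF (F : face K i) : #|val F|%:Z = i + 1 by case: F => F /= /andP[_ /eqP].
have FK j (F : face K j) : val F \in K by case: F => F /= /andP[].
have lowmu (G : {set V}) : G \in K -> low G -> G \subset mu G.
  move=> GK /eqP lG; case: (mu1 G GK) => [[e _]|[]//|[_ e]].
    by move: lG; rewrite e => /eqP; rewrite -[X in X == _]addn0 -addn1 eqn_add2l.
  by move: lG; rewrite e => /eqP; lia.
(* Clear the cells matched upwards, one value of the potential at a time. *)
have elim k : exists b : chain K (i + 1), forall G : face K i, low (val G) ->
    (rho (val G) < k)%N -> (c - @bd V K (i + 1) i b) G = 0.
  elim: k => [|k [b IH]]; first by exists 0.
  pose r := c - @bd V K (i + 1) i b.
  pose val_at (G : {set V}) := oapp r 0 (insub G : option (face K i)).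
  have val_atE (G : face K i) : val_at (val G) = r G by rewrite /val_at valK.
  pose b' : chain K (i + 1) := [ffun F : face K (i + 1) =>
    if low (mu (val F)) && (rho (mu (val F)) == k)
    then incidence (val F) (mu (val F)) * val_at (mu (val F)) else 0].
  exists (b + b') => G lG rG.
  rewrite raddfD opprD addrA /= ffunE [X in _ + X]ffunE -/r.
  suff -> : @bd V K (i + 1) i b' G = if rho (val G) == k then r G else 0.
    move: rG; rewrite ltnS leq_eqVlt; case: eqP => [_ _|_ /= rG]; first by rewrite subrr.
    by rewrite subr0; apply: IH.
  have [muG1 muG2] := muK _ (FK _ G).
  have upP : (mu (val G) \in K) && (#|mu (val G)|%:Z == i + 1 + 1).
    by rewrite muG1 (eqP lG) -addn1 PoszD cF eqxx.
  pose up : face K (i + 1) := Sub (mu (val G)) upP.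
  rewrite ffunE (bigD1 up) //= big1 ?addr0 => [|F nF].
    rewrite ffunE /= muG2 lG /=; case: eqP => _; last by rewrite mulr0.
    rewrite mulrA incidence_sq ?mul1r; first exact: val_atE.
      exact: lowmu (FK _ G) lG.
    exact/eqP.
  rewrite ffunE; case: ifP => [/andP[lF /eqP rF]|_]; last by rewrite mulr0.
  have [->|ne0] := eqVneq (incidence (val F) (val G)) 0; first by rewrite mul0r.
  have [GF cFG] := incidence_neq0 ne0.
  have [muF1 muF2] := muK _ (FK _ F).
  have neq : val G != mu (val F).
    by apply: contra nF => /eqP e; rewrite -val_eqE /= e muF2.
  have := acyc _ _ muF1 (FK _ G) (eqP lF); rewrite (eqP lG) => /(_ (leqnSn _)).
  rewrite muF2 rF => /(_ _ GF neq) h.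
  have : (k < rho (val G))%N by apply: h; move: (eqP lF); rewrite muF2 cFG => -[].
  by rewrite ltnNge -ltnS rG.
pose k0 := (\max_(G : {set V}) rho G).+1.
have [b hb] := elim k0; exists b; apply/esym/eqP; rewrite -subr_eq0; apply/eqP.
set r := c - _ in hb *.
have zr : @bd V K i (i - 1) r = 0.
  by rewrite raddfB /= zc sub0r bd_bd // oppr0.
have rlow (G : face K i) : low (val G) -> r G = 0.
  by move=> lG; apply: hb => //; rewrite ltnS /k0 leq_bigmax.
(* What remains is supported on cells matched downwards. *)
have rup k (F : face K i) : #|val F| = #|mu (val F)|.+1 -> (rho (mu (val F)) < k)%N ->
    r F = 0.
  elim: k F => // k IH F cF1 rF.
  have [muF1 muF2] := muK _ (FK _ F).
  have dnP : (mu (val F) \in K) && (#|mu (val F)|%:Z == i - 1 + 1).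
    by rewrite muF1 andTb; apply/eqP; have := cF F; rewrite cF1 -addn1 PoszD; lia.
  have FF : mu (val F) \subset val F.
    by rewrite -{2}muF2 lowmu // /low muF2 cF1.
  have := congr1 (fun x : chain K (i - 1) => x (Sub (mu (val F)) dnP)) zr.
  rewrite [in RHS]ffunE ffunE /= (bigD1 F) //= big1 ?addr0 => [|F' nF'].
    move: (incidence_sq FF cF1) => /=; set a := incidence _ _ => a2 e.
    by rewrite -[LHS]mul1r -{1}a2 -mulrA e mulr0.
  have [->|ne0] := eqVneq (incidence (val F') (mu (val F))) 0; first by rewrite mul0r.
  have [GF cFG] := incidence_neq0 ne0.
  case: (mu1 _ (FK _ F')) => [[_ s']|[_ lF']|[uF' cF']].
  - by case: (nS #|val F'|); rewrite ?cF.
  - by rewrite rlow ?mulr0 //; apply/eqP.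
  have [muF1' muF2'] := muK _ (FK _ F').
  rewrite IH ?mulr0 //.
  apply: leq_trans (_ : _ < rho (mu (val F)))%N _; last by rewrite -ltnS.
  apply: acyc => //; rewrite ?muF2 ?muF2' ?cF1 //.
  - by move: cFG; rewrite cF' => -[].
  - apply: contra nF' => /eqP e; rewrite -val_eqE /= -muF2' -muF2 e //.
apply/ffunP => F; rewrite [RHS]ffunE.
case: (mu1 _ (FK _ F)) => [[_ s']|[_ lF]|[_ cF1]].
- by case: (nS #|val F|); rewrite ?cF.
- by apply: rlow; apply/eqP.
- exact: (rup (rho (mu (val F))).+1).
Qed.

Lemma morse_weaken (V : finType) (K K' : {set V} -> Prop) (S S' : nat -> Prop) :
  (forall F, K F <-> K' F) -> (forall d, S d -> S' d) -> morse K S -> morse K' S'.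
Proof.
move=> eK sS [mu [rho [h1 h2 h3]]]; exists mu, rho; split=> [F /eK/h1[/eK]//|F /eK/h2|].
  by case=> [[e /sS]||] *; [apply: Or31|apply: Or32|apply: Or33].
by move=> G G' /eK KG /eK KG'; apply: h3.
Qed.

Lemma morse_point (V : finType) (K : {set V} -> Prop) :
  (forall F, K F -> F = set0) -> morse K (fun d => d = 0%N).
Proof.
move=> K0; exists id, (fun=> 0%N); split=> // F; last by move=> G _ _ /eqP; rewrite -addn1; lia.
by move=> /K0 ->; apply: Or31; rewrite cards0.
Qed.

(** Cells closed under adding and removing a fixed vertex form a cone, which is
    matched without critical cells. *)
Lemma morse_toggle (V : finType) (K : {set V} -> Prop) (S : nat -> Prop) (v : V) :
  (forall F, K F -> v \in F -> K (F :\ v)) ->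
  (forall F, K F -> v \notin F -> K (v |: F)) -> morse K S.
Proof.
move=> Kdel Kadd; exists (fun F : {set V} => if v \in F then F :\ v else v |: F), (fun=> 0%N).
split=> [F KF|F KF|G G' KG KG'].
- case: ifP => vF; first by rewrite !inE eqxx setD1K //; split=> //; apply: Kdel.
  by rewrite setU11 setU1K ?vF //; split=> //; apply: Kadd; rewrite ?vF.
- case: ifP => vF; last by apply: Or32; rewrite subsetUr cardsU1 vF.
  by apply: Or33; rewrite subsetDl (cardsD1 v F) vF.
case: ifP => vG; first by rewrite (cardsD1 v G) vG; lia.
case: ifP => vG'; first by rewrite (cardsD1 v G') vG'; lia.
move=> _ _ cGG' sub /eqP[]; apply/eqP; rewrite eqEcard cGG' leqnn andbT.
apply/subsetP => w wG'; have := subsetP sub w wG'; rewrite !inE.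
by case/orP => // /eqP ew; move: vG'; rewrite -ew wG'.
Qed.

Lemma lexicographic_lt (a a' b b' M : nat) : (b <= M)%N ->
  (a < a')%N \/ a = a' /\ (b < b')%N -> (a * M.+1 + b < a' * M.+1 + b')%N.
Proof. by move=> bM [h|[-> h]]; [nia | rewrite ltn_add2l]. Qed.

(** Matchings on the pieces of a filtration assemble: passing to a face either
    stays in the same piece or strictly raises the level. *)
Lemma morse_filter (V : finType) (T : Type) (K : {set V} -> Prop) (S : nat -> Prop)
    (p : {set V} -> T) (lev : T -> nat) :
  (forall F G, K F -> K G -> G \subset F ->
     p G = p F \/ (lev (p F) < lev (p G))%N) ->
  (forall t, morse (fun F => K F /\ p F = t) S) -> morse K S.
Proof.
move=> hp /choice[mu /choice[rho hmu]].
pose M := \max_F rho (p F) F.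
exists (fun F => mu (p F) F), (fun F => lev (p F) * M.+1 + rho (p F) F)%N.
split=> [F KF|F KF|G G' KG KG' lG lG' cG sub neq].
- have [/(_ F)[//|[Km pm] mm] _ _] := hmu (p F).
  by rewrite pm mm.
- by have [_ /(_ F)h _] := hmu (p F); apply: h.
have [h1 _ h3] := hmu (p G).
have [[Km pm] mm] := h1 G (conj KG erefl).
apply: lexicographic_lt; first exact: (leq_bigmax G).
case: (hp _ _ Km KG' sub) => [e|]; last by rewrite pm; left.
rewrite pm in e; right; rewrite e; split=> //.
by apply: h3 => //; rewrite -e.
Qed.

(** In a join of [K1] and [K2] with the fixed simplex [Z], match in the first
    factor, and use the second factor when the first one is critical.  The
    potential is lexicographic; its leading term is minus the dimension of the
    first factor, because a critical [L] gives no control of [rho1] on the faces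
    of [L]. *)
Lemma morse_product (V : finType) (K K1 K2 : {set V} -> Prop) (S S1 S2 : nat -> Prop)
    (V1 V2 Z : {set V}) :
  (forall L, K1 L -> L \subset V1) -> (forall R, K2 R -> R \subset V2) ->
  [disjoint V1 & V2] -> [disjoint Z & V1] -> [disjoint Z & V2] ->
  (forall F, K F <-> exists L R, [/\ K1 L, K2 R & F = Z :|: (L :|: R)]) ->
  (forall d1 d2, S1 d1 -> S2 d2 -> S (#|Z| + (d1 + d2))%N) ->
  morse K1 S1 -> morse K2 S2 -> morse K S.
Proof.
move=> sub1 sub2 dV dZ1 dZ2 KE SE [mu1 [rho1 [a1 b1 c1]]] [mu2 [rho2 [a2 b2 c2]]].
pose J (L R : {set V}) := Z :|: (L :|: R).
have dis0 (A B C D : {set V}) : A \subset C -> B \subset D -> [disjoint C & D] ->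
    A :&: B = set0.
  by move=> AC BD /(disjointWl AC)/(disjointWr BD)/disjoint_setI0.
have JL (L R : {set V}) : L \subset V1 -> R \subset V2 -> J L R :&: V1 = L.
  move=> hL hR; rewrite /J !setIUl (disjoint_setI0 dZ1) (setIidPl hL) set0U.
  by rewrite (dis0 _ _ _ _ hR (subxx V1)) ?setU0 // disjoint_sym.
have JR (L R : {set V}) : L \subset V1 -> R \subset V2 -> J L R :&: V2 = R.
  move=> hL hR; rewrite /J !setIUl (disjoint_setI0 dZ2) (setIidPl hR) set0U.
  by rewrite (dis0 _ _ _ _ hL (subxx V2)) ?set0U.
have Jcard (L R : {set V}) : L \subset V1 -> R \subset V2 ->
    #|J L R| = (#|Z| + (#|L| + #|R|))%N.
  move=> hL hR; rewrite /J cardsU setIUr.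
  rewrite (dis0 _ _ _ _ (subxx Z) hL dZ1) (dis0 _ _ _ _ (subxx Z) hR dZ2) setU0 cards0.
  by rewrite subn0 cardsU (dis0 _ _ _ _ hL hR dV) cards0 subn0.
have Jsub (L R L' R' : {set V}) : L \subset V1 -> R \subset V2 -> L' \subset V1 ->
    R' \subset V2 -> J L' R' \subset J L R -> L' \subset L /\ R' \subset R.
  move=> hL hR hL' hR' h; split.
    by rewrite -(JL L' R') // -(JL L R) // setSI.
  by rewrite -(JR L' R') // -(JR L R) // setSI.
have Jmono (L R L' R' : {set V}) : L' \subset L -> R' \subset R -> J L' R' \subset J L R.
  by move=> hL hR; rewrite /J setUS // setUSS.
pose mu (F : {set V}) := let L := F :&: V1 in let R := F :&: V2 in
  if mu1 L != L then J (mu1 L) R else J L (mu2 R).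
have muJ L R : K1 L -> K2 R -> mu (J L R) = if mu1 L != L then J (mu1 L) R else J L (mu2 R).
  by move=> /sub1 hL /sub2 hR; rewrite /mu JL // JR.
pose M1 := \max_L rho1 L; pose M2 := \max_R rho2 R.
exists mu, (fun F : {set V} => let L := F :&: V1 in let R := F :&: V2 in
  ((#|V| - #|L|) * M1.+1 + rho1 L) * M2.+1 + rho2 R)%N.
split=> [F /KE[L [R [KL KR ->]]]|F /KE[L [R [KL KR ->]]]|].
- have [KL' mL] := a1 L KL; have [KR' mR] := a2 R KR.
  rewrite -/(J L R) (muJ L R) //; case: ifP => nL.
    rewrite muJ // mL eq_sym nL; split=> //.
    by apply/KE; exists (mu1 L), R.
  rewrite muJ // nL mR; split=> //.
  by apply/KE; exists L, (mu2 R).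
- have [KL' mL] := a1 L KL; have [KR' mR] := a2 R KR.
  have [hL hL' hR hR'] := And4 (sub1 _ KL) (sub1 _ KL') (sub2 _ KR) (sub2 _ KR').
  rewrite -/(J L R) (muJ L R) // !Jcard //.
  case: (b1 L KL) => [[eL sL]|[sL cL]|[sL cL]].
  + rewrite eL eqxx /= Jcard //.
    case: (b2 R KR) => [[eR sR]|[sR cR]|[sR cR]].
    * by rewrite eR; apply: Or31; split=> //; apply: SE.
    * by apply: Or32; rewrite cR !addnS Jmono.
    * by apply: Or33; rewrite cR !addnS Jmono.
  + have -> : mu1 L != L by apply: contra_eqN cL => /eqP ->; rewrite eqn_leq ltnn andbF.
    by rewrite Jcard // cL; apply: Or32; rewrite addSn addnS Jmono.
  + have -> : mu1 L != L by apply: contra_eqN cL => /eqP ->; rewrite eqn_leq ltnn andbF.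
    by rewrite Jcard // cL; apply: Or33; rewrite addSn addnS Jmono.
move=> F F' /KE[L [R [KL KR ->]]] /KE[L' [R' [KL' KR' ->]]].
have [KmL mL] := a1 L KL; have [KmR mR] := a2 R KR.
have [KmL' mL'] := a1 L' KL'; have [KmR' mR'] := a2 R' KR'.
have [hL hmL hR hmR] := And4 (sub1 _ KL) (sub1 _ KmL) (sub2 _ KR) (sub2 _ KmR).
have [hL' hmL' hR' hmR'] := And4 (sub1 _ KL') (sub1 _ KmL') (sub2 _ KR') (sub2 _ KmR').
rewrite -/(J L R) -/(J L' R') !muJ // !JL // !JR //.
have notup : (#|J L' R'| <= #|if mu1 L' != L' then J (mu1 L') R' else J L' (mu2 R')|)%N ->
    (#|L'| <= #|mu1 L'|)%N /\ (mu1 L' = L' -> (#|R'| <= #|mu2 R'|)%N).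
  case: ifP => [nL|/negbFE/eqP eL]; rewrite !Jcard //.
    by rewrite leq_add2l leq_add2r => ->; split=> // eL; rewrite eL eqxx in nL.
  by rewrite !leq_add2l eL.
move=> lG /notup[nup1 nup2] cG sub neq; clear notup.
apply: lexicographic_lt; first exact: (leq_bigmax R).
case: ifP lG sub => [nL|/negbFE/eqP eL]; rewrite ?Jcard //.
  move=> cmL /Jsub[] // sL sR; move: cG; rewrite !Jcard // => cG.
  have cL : #|mu1 L| = #|L|.+1 by clear -cmL; lia.
  have leL := subset_leq_card sL; have leR := subset_leq_card sR.
  left; apply: lexicographic_lt; first exact: (leq_bigmax L).
  have [eR|nR] := eqVneq #|R'| #|R|.
    have eRR : R' = R by apply/eqP; rewrite eqEcard sR eR leqnn.
    have cLL : #|L'| = #|L| by clear -cG eR; lia.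
    right; rewrite cLL; split=> //; apply: c1 => //.
    by apply: contra neq => /eqP ->; rewrite eRR.
  have eLL : L' = mu1 L by apply/eqP; rewrite eqEcard sL; clear -cG cL leL leR nR; lia.
  by move: nup1; rewrite eLL mL cL ltnn.
move=> cmR /Jsub[] // sL sR; move: cG; rewrite !Jcard // => cG.
have cR : #|mu2 R| = #|R|.+1 by clear -cmR; lia.
have leL := subset_leq_card sL; have leR := subset_leq_card sR.
have [eLc|nLc] := eqVneq #|L'| #|L|.
  have eLL : L' = L by apply/eqP; rewrite eqEcard sL eLc leqnn.
  right; rewrite eLL; split=> //; apply: c2 => //.
  - by apply: nup2; rewrite eLL.
  - by clear -cG eLc; lia.
  by apply: contra neq => /eqP ->; rewrite eLL.
left; apply: lexicographic_lt; first exact: (leq_bigmax L).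
by left; have := max_card L; clear -leL nLc; lia.
Qed.

(** * Chains of sets with descents *)

Local Open Scope nat_scope.

(** For a chain [F] through [B]: [x] lies in the block of [F] that ends at [B],
    and [y] in the block that starts there. *)
Definition separates (n : nat) (F : {set {set 'I_n}}) (B : {set 'I_n}) (x y : 'I_n) : Prop :=
  forall C, C \in F -> (x \in C -> B \subset C) /\ (y \notin C -> C \subset B).

(** The faces of the h-complex of the interval from [X] to [Y]: chains of sets
    strictly between them such that, at every [B], some letter [x] of the block before
    [B] exceeds some letter [y] of the block after [B].  Working with intervals
    makes the parts of a chain below and above a member instances of the same
    notion. *)
Definition descent_chain (n : nat) (X Y : {set 'I_n}) (F : {set {set 'I_n}}) : Prop :=
  forall B, B \in F ->
  [/\ X \subset B, B \subset Y, forall C, C \in F -> B \subset C \/ C \subset B &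
      exists x y, [/\ x \in B :\: X, y \in Y :\: B, y < x & separates F B x y]].

Definition open_interval (n : nat) (X Y : {set 'I_n}) : {set {set 'I_n}} :=
  [set B : {set 'I_n} | X \proper B & B \proper Y].

(** The smallest member of the chain [F], completed by [Y], that contains [m]: the set
    reached at the end of the block of [m]. *)
Definition least_with (n : nat) (Y : {set 'I_n}) (m : 'I_n) (F : {set {set 'I_n}}) :
  {set 'I_n} := Y :&: \bigcap_(B in F | m \in B) B.

Lemma in_least_with (n : nat) (Y : {set 'I_n}) (m x : 'I_n) (F : {set {set 'I_n}}) :
  reflect (x \in Y /\ forall B, B \in F -> m \in B -> x \in B) (x \in least_with Y m F).
Proof.
rewrite inE; apply: (iffP andP) => [] [xY h]; split=> //.
  by move=> B BF mB; move/bigcapP: h; apply; rewrite BF.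
by apply/bigcapP => B /andP[]; apply: h.
Qed.

Lemma descent_chain_sub (n : nat) (X Y : {set 'I_n}) (F G : {set {set 'I_n}}) :
  G \subset F -> descent_chain X Y F -> descent_chain X Y G.
Proof.
move=> /subsetP GF gF B /GF/gF[XB BY cB [x [y [xB yB lt sep]]]].
by split=> // [C /GF/cB //|]; exists x, y; split=> // C /GF/sep.
Qed.

Lemma descent_chain_open (n : nat) (X Y : {set 'I_n}) (F : {set {set 'I_n}}) :
  descent_chain X Y F -> F \subset open_interval X Y.
Proof.
move=> gF; apply/subsetP => B /gF[XB BY _ [x [y [xB yB _ _]]]].
move: xB yB; rewrite !inE !properE XB BY /= => /andP[xX xB] /andP[yB yY].
by apply/andP; split; apply/subsetPn; [exists x|exists y].
Qed.

Lemma descent_chain_short (n : nat) (X Y : {set 'I_n}) (F : {set {set 'I_n}}) :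
  descent_chain X Y F -> #|Y| - #|X| <= 1 -> F = set0.
Proof.
move=> /descent_chain_open/subsetP sF le1; apply/setP => B; rewrite inE.
apply/negP => /sF; rewrite inE => /andP[/proper_card XB /proper_card BY].
by move: (leq_ltn_trans XB BY) le1 => *; lia.
Qed.

Lemma least_with_sub (n : nat) (Y : {set 'I_n}) (m : 'I_n) (F : {set {set 'I_n}}) B :
  B \in F -> m \in B -> least_with Y m F \subset B.
Proof. by move=> BF mB; apply/subsetP => x /in_least_with[_ /(_ B BF mB)]. Qed.

Lemma least_with_anti (n : nat) (Y : {set 'I_n}) (m : 'I_n) (F G : {set {set 'I_n}}) :
  G \subset F -> least_with Y m F \subset least_with Y m G.
Proof.
move=> /subsetP GF; apply/subsetP => x /in_least_with[xY h]; apply/in_least_with.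
by split=> // B /GF; apply: h.
Qed.

Lemma least_with_mem (n : nat) (X Y : {set 'I_n}) (m : 'I_n) (F : {set {set 'I_n}}) :
  descent_chain X Y F -> least_with Y m F != Y -> least_with Y m F \in F.
Proof.
move=> gF neY.
case: (pickP [pred B in F | m \in B]) => [B0 /= hB0|none]; last first.
  case/eqP: neY; apply/setP => x; apply/in_least_with/idP => [[]//|xY].
  by split=> // B BF mB; have := none B; rewrite /= BF mB.
case: (@arg_minnP _ B0 [pred B in F | m \in B] (fun B => #|B|) hB0) => B /= /andP[BF mB] minB.
have [_ BY cB _] := gF B BF.
suff -> : least_with Y m F = B by [].
apply/setP => x; apply/in_least_with/idP => [[_ /(_ B BF mB)]//|xB].
split=> [|C CF mC]; first exact: (subsetP BY).
case: (cB C CF) => [/subsetP/(_ x xB)//|CB].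
suff -> : C = B by [].
by apply/eqP; rewrite eqEcard CB minB //= CF.
Qed.

(** The letter produced lies in the first block. *)
Lemma descent_chain_first (n : nat) (X Y : {set 'I_n}) (F : {set {set 'I_n}}) :
  descent_chain X Y F -> X \proper Y ->
  exists2 y, y \in Y :\: X & forall C, C \in F -> y \in C.
Proof.
move=> gF XY; case: (set_0Vmem F) => [->|[B0 B0F]].
  by case/properP: XY => XY [y yY yX]; exists y; rewrite ?inE ?yX // => C; rewrite inE.
case: (@arg_minnP _ B0 (mem F) (fun B => #|B|) B0F) => B BF minB.
have [_ BY cB [x [y [xB _ _ _]]]] := gF B BF.
move: xB; rewrite inE => /andP[xX xB].
exists x; first by rewrite inE xX (subsetP BY).
move=> C CF; case: (cB C CF) => [/subsetP/(_ x xB)//|CB].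
suff -> : C = B by [].
by apply/eqP; rewrite eqEcard CB minB.
Qed.

(** The letter produced lies in the last block. *)
Lemma descent_chain_last (n : nat) (X Y : {set 'I_n}) (F : {set {set 'I_n}}) :
  descent_chain X Y F -> X \proper Y ->
  exists2 x, x \in Y :\: X & forall C, C \in F -> x \notin C.
Proof.
move=> gF XY; case: (set_0Vmem F) => [->|[B0 B0F]].
  by case/properP: XY => XY [y yY yX]; exists y; rewrite ?inE ?yX // => C; rewrite inE.
case: (@arg_maxnP _ B0 (mem F) (fun B => #|B|) B0F) => B BF maxB.
have [XB BY cB [_ [y [_ yB _ _]]]] := gF B BF.
move: yB; rewrite inE => /andP[yB yY].
exists y; first by rewrite inE yY andbT; apply: contra yB; apply/subsetP.
move=> C CF; case: (cB C CF) => [BC|CB]; last by apply: contra yB; apply/subsetP.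
suff -> : C = B by [].
by apply/eqP; rewrite eq_sym eqEcard BC; apply: maxB.
Qed.

(** Cutting at the block of the largest letter [m].  Once [m] is deleted the part up
    to its block is an arbitrary descent chain, because [m] exceeds every letter that follows
    it and is never the smaller letter of a descent.  When [A = Y] there is no
    bar after [m] and [R] is empty. *)
Lemma split_at_max (n : nat) (X Y A : {set 'I_n}) (m : 'I_n) (F : {set {set 'I_n}}) :
  X \subset A -> A \subset Y -> m \in A -> m \notin X ->
  (forall z, z \in Y -> z \notin X -> z != m -> z < m) ->
  (descent_chain X Y F /\ least_with Y m F = A) <->
  exists L R, [/\ descent_chain X (A :\ m) L, descent_chain A Y R &
    F = (if A == Y then set0 else [set A]) :|: (L :|: R)].
Proof.
move=> XA AY mA mX mmax; split=> [[gF eA]|[L [R [gL gR ->]]]].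
  pose L := [set B in F | m \notin B]; pose R := [set B in F | A \proper B].
  have LF : L \subset F by apply/subsetP => B; rewrite inE => /andP[].
  have RF : R \subset F by apply/subsetP => B; rewrite inE => /andP[].
  have AF : A != Y -> A \in F by rewrite -eA; apply: least_with_mem gF.
  have belowA B : B \in F -> m \notin B -> B \subset A :\ m.
    move=> BF mB; have [_ BY cB _] := gF B BF.
    rewrite subsetD1 mB andbT; have [->//|/AF AinF] := eqVneq A Y.
    by case: (cB A AinF) => // /subsetP/(_ m mA); rewrite (negPf mB).
  exists L, R; split.
  - move=> B BL; have := BL; rewrite inE => /andP[BF mB].
    have [XB BY cB [x [y [xB yB lt sep]]]] := gF B BF.
    split=> //; [exact: belowA | by move=> C /(subsetP LF)/cB |].
    exists x, y; split=> //; last by move=> C /(subsetP LF)/sep.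
    move: xB yB; rewrite !inE => /andP[xX xB] /andP[yB yY]; rewrite yB /=.
    apply/andP; split.
      apply: contraTneq lt => ->; rewrite -leqNgt.
      have [->//|nxm] := eqVneq x m; apply/ltnW/mmax => //.
      exact: (subsetP BY).
    have [->//|/AF AinF] := eqVneq A Y.
    apply/negPn/negP => /(proj2 (sep A AinF))/subsetP/(_ m mA).
    by rewrite (negPf mB).
  - move=> B BR; have := BR; rewrite inE => /andP[BF /properP[AB _]].
    have [XB BY cB [x [y [xB yB lt sep]]]] := gF B BF.
    split=> //; first by move=> C /(subsetP RF)/cB.
    exists x, y; split=> //; last by move=> C /(subsetP RF)/sep.
    move: xB; rewrite !inE => /andP[xX xB]; rewrite xB andbT.
    have AinF : A \in F.
      apply: AF; move: BR; rewrite inE => /andP[_]; apply: contraTneq => ->.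
      by rewrite properE BY andbF.
    apply/negP => /(proj1 (sep A AinF)) BA.
    by move: BR; rewrite inE properE BA !andbF.
  - apply/setP => B; rewrite !inE.
    have -> : (B \in (if A == Y then set0 else [set A])) = (A != Y) && (B == A).
      by case: (A == Y); rewrite !inE.
    apply/idP/idP => [BF|/orP[/andP[nAY /eqP ->]|/orP[]/andP[]//]]; last exact: AF.
    rewrite BF /=; case: (boolP (m \in B)) => mB; last by rewrite orbT.
    have AB : A \subset B by rewrite -eA; apply: least_with_sub.
    rewrite /= properEneq AB andbT; have [eBA|nBA] := eqVneq B A; last by rewrite orbT.
    have := descent_chain_open gF; move/subsetP/(_ B BF); rewrite inE eBA andbT.
    by case/andP=> _; rewrite properEneq => /andP[->].
set Z := if _ then _ else _.
have ZE B : (B \in Z) = (A != Y) && (B == A).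
  by rewrite /Z; case: (A == Y); rewrite !inE.
have RinA B : B \in R -> A \proper B.
  by move=> /(subsetP (descent_chain_open gR)); rewrite inE => /andP[].
have LinA B : B \in L -> B \subset A :\ m by move=> /gL[].
have LinA' B : B \in L -> B \subset A by move=> /LinA/subset_trans; apply; apply: subD1set.
have mL B : B \in L -> m \notin B.
  by move=> /LinA; rewrite subsetD1 => /andP[].
split; last first.
  apply/setP => x; apply/in_least_with/idP => [[xY h]|xA].
    have [e|nAY] := eqVneq A Y; first by rewrite e.
    by apply: h => //; rewrite !inE ZE nAY eqxx.
  split=> [|B]; first exact: (subsetP AY).
  rewrite !inE ZE => /orP[/andP[_ /eqP ->]//|/orP[/mL/negPf ->//|/RinA]].
  by move=> /proper_sub/subsetP AB _; apply: AB.
move=> B; rewrite !inE ZE => /orP[/andP[nAY /eqP ->]|/orP[BL|BR]].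
- have AprY : A \proper Y by rewrite properEneq nAY.
  have [y yA yR] := descent_chain_first gR AprY.
  split=> // [C|].
    rewrite !inE ZE => /orP[/andP[_ /eqP ->]|/orP[/LinA'|/RinA/proper_sub]]; by [left|right|left].
  exists m, y; split=> //; first by rewrite inE mX.
    move: yA; rewrite inE => /andP[yA yY]; apply: mmax => //.
      by apply: contra yA; apply/subsetP.
    by apply: contraNneq yA => ->.
  move=> C; rewrite !inE ZE => /orP[/andP[_ /eqP ->]//|/orP[CL|CR]].
    by split=> [mC|_]; [move: (mL C CL); rewrite mC|apply: LinA'].
  by split=> [_|/negP[]]; [apply/proper_sub/RinA|apply: yR].
- have [XB BA cB [x [y [xB yB lt sep]]]] := gL B BL.
  have BA' := LinA' B BL.
  move: (yB); rewrite !inE => /and3P[yB1 ym yA].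
  split=> // [|C|]; first exact: subset_trans BA' AY.
    rewrite !inE ZE => /orP[/andP[_ /eqP ->]|/orP[/cB//|/RinA/proper_sub h]]; left=> //.
    exact: subset_trans BA' h.
  exists x, y; split=> //; first by rewrite inE yB1 (subsetP AY).
  move=> C; rewrite !inE ZE => /orP[/andP[_ /eqP ->]|/orP[/sep//|/RinA/proper_sub AC]].
    by rewrite yA.
  by split=> [_|/negP[]]; [apply: subset_trans AC|apply: (subsetP AC)].
have [AB BY cB [x [y [xB yB lt sep]]]] := gR B BR.
move: (xB); rewrite !inE => /andP[xA xB1].
split=> // [|C|]; first exact: subset_trans XA AB.
  rewrite !inE ZE => /orP[/andP[_ /eqP ->]|/orP[/LinA' h|/cB//]]; right=> //.
  exact: subset_trans h AB.
exists x, y; split=> //; first by rewrite inE xB1 andbT; apply: contra xA; apply/subsetP.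
move=> C; rewrite !inE ZE => /orP[/andP[_ /eqP ->]|/orP[/LinA' CA|/sep//]].
  by rewrite (negPf xA).
split=> [xC|_]; last exact: subset_trans CA AB.
by case/negP: xA; apply: (subsetP CA).
Qed.

(** * The matching *)

(** Numbers [d] of bars for which [s] letters have homology; the interval with
    no letter contributes only its empty chain, as a factor in products. *)
Definition homology_range (s d : nat) : Prop :=
  s = 0 /\ d = 0 \/ s <= 3 * d + 1 /\ 3 * d + 2 <= 2 * s.

(** The numbers of bars add up for [m | U p | V].  Here [x], [a], [y] are the
    numbers of letters in the sets at the start, at the block of [p] and at the
    end, and [b] tells whether [V] is nonempty. *)
Lemma range_m_Up_V (x a y d1 d2 : nat) (b : bool) :
  x + 3 <= a -> a <= y -> (b -> a < y) -> (~~ b -> a = y) ->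
  homology_range (a.-1 - x.+1) d1 -> homology_range (y - a) d2 ->
  homology_range (y - x) (b.+1 + (d1 + d2)).
Proof. by rewrite /homology_range; case: b => /= *; lia. Qed.

(** The same for [U m | V], with [a] at the block of [m]. *)
Lemma range_Um_V (x a y d1 d2 : nat) :
  x.+1 < a -> a < y -> homology_range (a.-1 - x) d1 -> homology_range (y - a) d2 ->
  homology_range (y - x) (1 + (d1 + d2)).
Proof. rewrite /homology_range; lia. Qed.

(** The same for [U p | V m], where [U] may be empty, with [a] at the block of
    [p]. *)
Lemma range_Up_Vm (x a y d1 d2 : nat) :
  x < a -> a < y.-1 -> homology_range (a.-1 - x) d1 -> homology_range (y.-1 - a) d2 ->
  homology_range (y - x) (1 + (d1 + d2)).
Proof. rewrite /homology_range; lia. Qed.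

Lemma open_interval_disjoint (n : nat) (X1 Y1 X2 Y2 : {set 'I_n}) :
  Y1 \subset X2 -> [disjoint open_interval X1 Y1 & open_interval X2 Y2].
Proof.
move=> YX; rewrite -setI_eq0; apply/eqP/setP => B; rewrite !inE.
apply/negP => /andP[/andP[_ BY] /andP[XB _]].
by have := proper_sub_trans BY (subset_trans YX (proper_sub XB)); rewrite properxx.
Qed.

(** The chains [Z], [L] and [R] live on disjoint sets of vertices because [Z] avoids
    the two open intervals, so a piece made of such unions is a join. *)
Lemma morse_split (n : nat) (X1 Y1 X2 Y2 : {set 'I_n})
    (K : {set {set 'I_n}} -> Prop) (Z : {set {set 'I_n}}) (S S1 S2 : nat -> Prop) :
  Y1 \subset X2 ->
  (forall B, B \in Z -> B \subset X1 \/ Y1 \subset B /\ B \subset X2 \/ Y2 \subset B) ->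
  X1 \subset Y1 -> X2 \subset Y2 ->
  (forall F, K F <-> exists L R,
     [/\ descent_chain X1 Y1 L, descent_chain X2 Y2 R & F = Z :|: (L :|: R)]) ->
  (forall d1 d2, S1 d1 -> S2 d2 -> S (#|Z| + (d1 + d2))) ->
  morse (descent_chain X1 Y1) S1 -> morse (descent_chain X2 Y2) S2 -> morse K S.
Proof.
move=> YX hZ XY1 XY2 KE SE.
apply: (@morse_product _ _ _ _ _ _ _ (open_interval X1 Y1) (open_interval X2 Y2) Z) => //.
- by move=> L /descent_chain_open.
- by move=> R /descent_chain_open.
- exact: open_interval_disjoint.
- rewrite -setI_eq0; apply/eqP/setP => B; rewrite !inE.
  apply/negP => /and3P[/hZ h XB BY]; move: h => [BX|[[YB _]|YB]].
  + by have := proper_sub_trans XB BX; rewrite properxx.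
  + by have := proper_sub_trans BY YB; rewrite properxx.
  + have := proper_sub_trans BY (subset_trans YX (subset_trans XY2 YB)).
    by rewrite properxx.
- rewrite -setI_eq0; apply/eqP/setP => B; rewrite !inE.
  apply/negP => /and3P[/hZ h XB BY]; move: h => [BX|[[_ BX]|YB]].
  + have := proper_sub_trans XB (subset_trans BX (subset_trans XY1 YX)).
    by rewrite properxx.
  + by have := proper_sub_trans XB BX; rewrite properxx.
  + by have := proper_sub_trans BY YB; rewrite properxx.
Qed.

Lemma morse_inhabited (V : finType) (K : {set V} -> Prop) (S : nat -> Prop) :
  (forall F, K F -> morse K S) -> morse K S.
Proof.
move=> h; case: (pselect (exists F, K F)) => [[F KF]|none]; first exact: (h F).
by exists id, (fun=> 0); split=> [F KF|F KF|F G KF _]; case: none; exists F.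
Qed.

(** The faces [m | p | T] and [m p | T] differ by the vertex [m |: X]. *)
Lemma morse_cone (n : nat) (X Y : {set 'I_n}) (m p : 'I_n)
    (K : {set {set 'I_n}} -> Prop) (S : nat -> Prop) :
  m \in Y -> m \notin X -> p \in Y -> p \notin X -> p < m -> X \subset Y ->
  (forall z, z \in Y -> z \notin X -> z != m -> z != p -> z < p) ->
  (forall F, K F <-> descent_chain X Y F /\
     (least_with Y m F = m |: (p |: X) \/
      least_with Y m F = m |: X /\ least_with Y p F = m |: (p |: X))) ->
  morse K S.
Proof.
move=> mY mX pY pX pm XY small KE; apply: (@morse_toggle _ _ _ (m |: X)).
- move=> F /KE[gF hF] mXF; apply/KE.
  have gG := descent_chain_sub (subD1set F (m |: X)) gF; split=> //; left.
  have e : least_with Y p F = m |: (p |: X).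
    case: hF => [e|[]//].
    have /subsetP/(_ p) := least_with_sub Y mXF (setU11 m X).
    rewrite e !inE eqxx orbT (negPf pX) orbF => /(_ isT)/eqP epm.
    by move: pm; rewrite epm ltnn.
  have eY : m |: (p |: X) = Y \/ m |: (p |: X) \in F.
    rewrite -e; have [->|ne] := eqVneq (least_with Y p F) Y; first by left.
    by right; apply: least_with_mem gF ne.
  have neq : m |: (p |: X) != m |: X.
    apply/negP => /eqP/setP/(_ p); rewrite !inE eqxx orbT (negPf pX) orbF.
    by move=> /esym/eqP epm; move: pm; rewrite epm ltnn.
  apply/setP => x; apply/in_least_with/idP => [[xY h]|xA].
    case: eY => [->//|eF]; apply: h; last exact: setU11.
    by rewrite !inE neq.
  have xY : x \in Y.
    by move: xA; rewrite !inE => /or3P[/eqP->|/eqP->|/(subsetP XY)].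
  split=> // B; rewrite !inE => /andP[nB BF] mB.
  have [XB BY cB _] := gF B BF.
  have pB : p \in B.
    apply: contraNT nB => pB.
    have BA : B \subset m |: (p |: X).
      case: eY => [->//|/cB[//|/subsetP/(_ p)]].
      by rewrite !inE eqxx orbT => /(_ isT); rewrite (negPf pB).
    rewrite eqEsubset subUset sub1set mB XB !andbT; apply/subsetP => z zB.
    have := subsetP BA z zB; rewrite !inE => /or3P[->//|/eqP ezp|->]; last by rewrite orbT.
    by rewrite -ezp zB in pB.
  by move: xA; rewrite !inE => /or3P[/eqP->|/eqP->|/(subsetP XB)].
move=> F /KE[gF hF] mXF; apply/KE.
have mp : m != p by apply: contraTneq pm => ->; rewrite ltnn.
have pmX : p \notin m |: X by rewrite !inE eq_sym (negPf mp).
have {hF} e : least_with Y m F = m |: (p |: X).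
  case: hF => [//|[e _]]; case/negP: mXF; rewrite -e; apply: least_with_mem gF _.
  by rewrite e; apply: contraNneq pmX => ->.
have eY : m |: (p |: X) = Y \/ m |: (p |: X) \in F.
  rewrite -e; have [->|ne] := eqVneq (least_with Y m F) Y; first by left.
  by right; apply: least_with_mem gF ne.
have above B : B \in F -> m |: (p |: X) \subset B.
  move=> BF; have [XB BY cB [x [y [xB yB lt sep]]]] := gF B BF.
  case: (boolP (m \in B)) => mB; first by rewrite -e least_with_sub.
  have BA : B \subset m |: (p |: X).
    case: eY => [->//|/cB[//|/subsetP/(_ m)]].
    by rewrite setU11 (negPf mB) => /(_ isT).
  move: xB yB; rewrite !inE => /andP[xX xB] /andP[yB yY].
  have xp : x = p.
    have := subsetP BA x xB; rewrite !inE (negPf xX) orbF => /orP[/eqP exm|/eqP//].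
    by rewrite -exm xB in mB.
  have yA : y \in m |: (p |: X).
    case: eY => [->//|/sep[_ h]]; apply/negPn/negP => /h AB.
    by move/subsetP/(_ m): AB; rewrite setU11 (negPf mB) => /(_ isT).
  move: yA; rewrite !inE => /or3P[/eqP eym|/eqP eyp|yX].
  - by move: lt; rewrite eym xp => lt; have := ltn_trans pm lt; rewrite ltnn.
  - by move: lt; rewrite eyp xp ltnn.
  - by rewrite (subsetP XB) in yB.
have aboveX B : B \in F -> m |: X \subset B.
  by move=> /above; apply: subset_trans; rewrite setUS // subsetUr.
have mXY : m |: X \subset Y by rewrite subUset sub1set mY.
have abm B : B \in F -> m \in B by move=> /above/subsetP; apply; apply: setU11.
have abp B : B \in F -> p \in B.
  by move=> /above/subsetP; apply; rewrite !inE eqxx orbT.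
split.
  move=> B /setU1P[->|BF].
    split=> //; first exact: subsetUr.
      by move=> C /setU1P[->|/aboveX]; left.
    exists m, p; split=> //; first by rewrite !inE eqxx mX.
      by rewrite inE pmX.
    move=> C /setU1P[->|CF]; first by split.
    by rewrite abp //; split=> // _; apply: aboveX.
  have [XB BY cB [x [y [xB yB lt sep]]]] := gF B BF.
  split=> // [C /setU1P[->|/cB//]|]; first by right; apply: aboveX.
  have [eB|nB] := eqVneq B (m |: (p |: X)).
    exists p, y; split=> //; first by rewrite inE pX abp.
      move: yB; rewrite eB !inE !negb_or => /andP[/and3P[ym yp yX] yY].
      exact: small.
    move=> C /setU1P[->|CF].
      by rewrite (negPf pmX); split=> // _; apply: aboveX.
    by split=> [_|]; [rewrite eB; apply: above|case: (sep C CF)].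
  exists x, y; split=> // C /setU1P[->|/sep//].
  split=> [xmX|_]; last exact: aboveX.
  case/negP: nB; rewrite eqEsubset above // andbT.
  case: eY => [->//|/sep[h _]]; apply: h.
  by apply: (subsetP _ _ xmX); rewrite setUS // subsetUr.
right; split.
  apply/eqP; rewrite eqEsubset least_with_sub ?setU11 //=.
  apply/subsetP => x xX; apply/in_least_with; split; first exact: (subsetP mXY).
  by move=> B /setU1P[->//|/aboveX/subsetP BX _]; apply: BX.
rewrite -e; apply/setP => x; apply/in_least_with/in_least_with => -[xY h]; split=> // B.
  by move=> BF _; apply: h; rewrite ?inE ?BF ?orbT ?abp.
by move=> /setU1P[->|BF]; [rewrite (negPf pmX)|move=> _; apply: h => //; apply: abm].
Qed.

(** The faces [T m | p] and [T p m] differ by the vertex [Y :\ p]. *)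
Lemma morse_cocone (n : nat) (X Y : {set 'I_n}) (m p : 'I_n)
    (K : {set {set 'I_n}} -> Prop) (S : nat -> Prop) :
  m \in Y -> m \notin X -> p \in Y -> p \notin X -> p < m -> X \subset Y ->
  (forall z, z \in Y -> z \notin X -> z != m -> z != p -> z < p) ->
  (forall F, K F <-> descent_chain X Y F /\
     (least_with Y m F = Y /\ least_with (Y :\ m) p F = Y :\ m \/
      least_with Y m F = Y :\ p)) ->
  morse K S.
Proof.
move=> mY mX pY pX pm XY small KE.
have mp : m != p by apply: contraTneq pm => ->; rewrite ltnn.
have mmax z : z \in Y -> z \notin X -> z != m -> z < m.
  move=> zY zX zm; have [->//|zp] := eqVneq z p.
  by apply: ltn_trans pm; apply: small.
have mYp : m \in Y :\ p by rewrite !inE mp.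
apply: (@morse_toggle _ _ _ (Y :\ p)).
- move=> F /KE[gF hF] YpF; apply/KE.
  have gG := descent_chain_sub (subD1set F (Y :\ p)) gF; split=> //; left.
  have e : least_with Y m F = Y :\ p.
    case: hF => [[e _]|//]; have := least_with_sub Y YpF mYp.
    by rewrite e => /subsetP/(_ p pY); rewrite !inE eqxx.
  split; apply/setP => x; apply/in_least_with/idP => [[]//|xY]; split=> // B;
      rewrite !inE => /andP[nB BF] inB; have [XB BY cB _] := gF B BF.
    have AB : Y :\ p \subset B by rewrite -e; apply: least_with_sub.
    have [exp|nxp] := eqVneq x p; last by apply: (subsetP AB); rewrite !inE nxp.
    apply: contraNT nB; rewrite exp => pB; rewrite eqEsubset AB andbT.
    by rewrite subsetD1 BY.
  case: (cB _ YpF) => [/subsetP/(_ p inB)|AB]; first by rewrite !inE eqxx.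
  have [->//|nxp] := eqVneq x p; apply: (subsetP AB); rewrite !inE nxp.
  by move: xY; rewrite !inE => /andP[].
move=> F /KE[gF hF] YpF; apply/KE.
have {hF} [e1 e2] : least_with Y m F = Y /\ least_with (Y :\ m) p F = Y :\ m.
  case: hF => // e; case/negP: YpF; rewrite -e; apply: least_with_mem gF _.
  by rewrite e; apply: contraTneq pY => <-; rewrite !inE eqxx.
have nm B : B \in F -> m \notin B.
  move=> BF; apply/negP => /(least_with_sub Y BF); rewrite e1 => YB.
  have := subsetP (descent_chain_open gF) B BF; rewrite inE !properE YB.
  by rewrite !andbF.
have np B : B \in F -> p \notin B.
  move=> BF; apply/negP => /(least_with_sub (Y :\ m) BF); rewrite e2 => YB.
  have [_ _ _ [x [y [xB yB lt _]]]] := gF B BF.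
  move: xB yB; rewrite !inE => /andP[xX xB] /andP[yB yY].
  have ym : y = m.
    by apply/eqP; apply: contraNT yB => ym; apply: (subsetP YB); rewrite !inE ym.
  have xm : x != m by apply: contraNneq (nm B BF) => <-.
  have xY : x \in Y by have [_ /subsetP BY _ _] := gF B BF; apply: BY.
  by have := ltn_trans lt (mmax x xY xX xm); rewrite ym ltnn.
have BYp B : B \in F -> B \subset Y :\ p.
  by move=> BF; rewrite subsetD1 np // andbT; have [] := gF B BF.
split.
  move=> B /setU1P[->|BF].
    split; [by rewrite subsetD1 XY | exact: subD1set | |].
      by move=> C /setU1P[->|/BYp]; [left|right].
    exists m, p; split=> //; [by rewrite !inE mX mp mY | by rewrite !inE eqxx pY |].
    move=> C /setU1P[->|CF]; first by split.
    by rewrite (negPf (nm C CF)); split=> // _; apply: BYp.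
  have [XB BY cB [x [y [xB yB lt sep]]]] := gF B BF.
  split=> // [C /setU1P[->|/cB//]|]; first by left; apply: BYp.
  exists x, y; split=> // C /setU1P[->|/sep//].
  split=> [_|]; first exact: BYp.
  move: xB yB; rewrite !inE => /andP[xX xB] /andP[yB yY].
  rewrite yY andbT negbK => /eqP eyp; move: lt; rewrite eyp => px.
  have xm : x != m by apply: contraNneq (nm B BF) => <-.
  have xp : x != p by apply: contraNneq (np B BF) => <-.
  by have := ltn_trans px (small x (subsetP BY x xB) xX xm xp); rewrite ltnn.
right; apply/eqP; rewrite eqEsubset least_with_sub ?setU11 //=.
apply/subsetP => x xYp; apply/in_least_with; split.
  by move: xYp; rewrite !inE => /andP[].
by move=> B /setU1P[->//|/nm/negPf ->].
Qed.

(** The piece of a face, coded by the sets at which [m] and [p] appear: 0 for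
    [m | p | T] and [m p | T], 1 for [m | U p | V], 2 for [U m | V], 3 for
    [U p | V m], 4 for [T m | p] and [T p m]. *)
Definition position (n : nat) (X Y : {set 'I_n}) (m p : 'I_n) (F : {set {set 'I_n}}) :
  nat * {set 'I_n} :=
  let A := least_with Y m F in
  let B := least_with Y p F in
  let C := least_with (Y :\ m) p F in
  if A == m |: (p |: X) then (0, set0)
  else if A == m |: X then if B == m |: (p |: X) then (0, set0) else (1, B)
  else if A == Y then if C == Y :\ m then (4, set0) else (3, C)
  else if A == Y :\ p then (4, set0)
  else (2, A).

Definition level (n : nat) (t : nat * {set 'I_n}) : nat := t.1 * n.+1 + #|t.2|.

Lemma level_lt (n a b : nat) (A B : {set 'I_n}) : a < b -> level (a, A) < level (b, B).
Proof.
move=> ab; rewrite /level /=; apply: (@leq_trans (a.+1 * n.+1)).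
  by rewrite mulSn addnC ltn_add2r ltnS -[X in _ <= X]card_ord max_card.
by apply: leq_trans (leq_addr _ _); rewrite leq_mul2r ab orbT.
Qed.

Lemma level_sub (n a : nat) (A B : {set 'I_n}) : A \subset B ->
  (a, B) = (a, A) \/ level (a, A) < level (a, B).
Proof.
move=> AB; have [->|nAB] := eqVneq A B; [by left | right].
by rewrite /level ltn_add2l proper_card // properEneq nAB.
Qed.

Lemma least_with_top (n : nat) (X Y : {set 'I_n}) (m : 'I_n) (F : {set {set 'I_n}}) :
  descent_chain X Y F -> m \in Y -> X \subset Y -> m |: X \subset least_with Y m F.
Proof.
move=> gF mY XY; apply/subsetP => x /setU1P xX; apply/in_least_with; split.
  by case: xX => [->|/(subsetP XY)].
by move=> B /gF[XB _ _ _] mB; case: xX => [->//|/(subsetP XB)].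
Qed.

(** Removing vertices merges blocks, so the sets at which [m] and [p] appear can
    only grow.  The pieces are numbered so that this never leads back. *)
Lemma position_mono (n : nat) (X Y : {set 'I_n}) (m p : 'I_n) (F G : {set {set 'I_n}}) :
  m \in Y -> m \notin X -> p \in Y -> p \notin X -> p != m -> X \subset Y ->
  descent_chain X Y F -> G \subset F ->
  position X Y m p G = position X Y m p F \/
  level (position X Y m p F) < level (position X Y m p G).
Proof.
move=> mY mX pY pX pm XY gF GF; have gG := descent_chain_sub GF gF.
have A1 := least_with_top gF mY XY; have A2 := least_with_anti Y m GF.
have B1 := least_with_top gF pY XY; have B2 := least_with_anti Y p GF.
have C2 := least_with_anti (Y :\ m) p GF.
have AY : least_with Y m G \subset Y by apply: subsetIl.
have CY : least_with (Y :\ m) p G \subset Y :\ m by apply: subsetIl.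
have pmX : p \notin m |: X by rewrite !inE (negPf pm).
rewrite /position.
have [e0|n0] := eqVneq (least_with Y m F) (m |: (p |: X)).
  by do ?[case: ifP => _]; first [by left | by right; apply: level_lt].
have [e1|n1] := eqVneq (least_with Y m F) (m |: X).
  have [eB|nB] := eqVneq (least_with Y p F) (m |: (p |: X)).
    by do ?[case: ifP => _]; first [by left | by right; apply: level_lt].
  have mXF : m |: X \in F.
    rewrite -e1; apply: least_with_mem gF _.
    by rewrite e1; apply: contraNneq pmX => ->.
  have mB : m |: (p |: X) \subset least_with Y p F.
    rewrite subUset B1 andbT sub1set; apply/in_least_with; split=> // B BF pB.
    have [_ _ cB _] := gF B BF; case: (cB _ mXF) => [/subsetP/(_ p pB)|/subsetP/(_ m)].
      by rewrite (negPf pmX).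
    by apply; apply: setU11.
  have nG0 : least_with Y m G != m |: (p |: X).
    apply: contra nB => /eqP eG; rewrite eqEsubset mB andbT.
    have [eY|nY] := eqVneq (m |: (p |: X)) Y; first by rewrite eY subsetIl.
    apply: least_with_sub; last by rewrite !inE eqxx orbT.
    by rewrite -eG (subsetP GF) // (least_with_mem gG) // eG.
  rewrite (negPf nG0); case: ifP => _; last first.
    by do ?[case: ifP => _]; right; apply: level_lt.
  case: ifP => [/eqP eBG|_]; last exact: level_sub.
  by case/negP: nB; rewrite eqEsubset mB andbT -eBG.
have nG1 : least_with Y m G != m |: X.
  by apply: contra n1 => /eqP eG; rewrite eqEsubset A1 andbT -eG.
have nG0 : least_with Y m G != m |: (p |: X).
  apply/eqP => eG; rewrite eG in A2.
  case: (boolP (p \in least_with Y m F)) => pA.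
    case/eqP: n0; apply/eqP; rewrite eqEsubset A2 /=.
    apply/subsetP => x /setU1P[->|/setU1P[->//|xX]]; apply: (subsetP A1).
      exact: setU11.
    by rewrite inE xX orbT.
  case/eqP: n1; apply/eqP; rewrite eqEsubset A1 andbT; apply/subsetP => x xA.
  have := subsetP A2 x xA; rewrite !inE => /or3P[->//|/eqP exp|->]; last by rewrite orbT.
  by rewrite -exp xA in pA.
rewrite (negPf nG1) (negPf nG0).
have [e2|n2] := eqVneq (least_with Y m F) Y.
  have -> : least_with Y m G = Y by apply/eqP; rewrite eqEsubset AY -{1}e2.
  rewrite eqxx; have [eC|nC] := eqVneq (least_with (Y :\ m) p F) (Y :\ m).
    have -> : least_with (Y :\ m) p G = Y :\ m by apply/eqP; rewrite eqEsubset CY -{1}eC.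
    by rewrite eqxx; left.
  by case: ifP => _; [right; apply: level_lt|apply: level_sub].
have [e3|n3] := eqVneq (least_with Y m F) (Y :\ p).
  case: ifP => [_|/eqP nY].
    have AF : Y :\ p \in F by rewrite -e3; apply: least_with_mem gF n2.
    have -> : least_with (Y :\ m) p G = Y :\ m.
      apply/eqP; rewrite eqEsubset CY; apply/subsetP => x xYm; apply/in_least_with.
      split=> // B /(subsetP GF) BF pB; have [_ BY cB _] := gF B BF.
      case: (cB _ AF) => [/subsetP/(_ p pB)|AB]; first by rewrite !inE eqxx.
      have [->//|xp] := eqVneq x p; apply: (subsetP AB); rewrite !inE xp.
      by move: xYm; rewrite !inE => /andP[].
    by rewrite eqxx; left.
  have eG : least_with Y m G = Y :\ p.
    apply/eqP; rewrite eqEsubset -{2}e3 A2 andbT subsetD1 AY /=.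
    apply/negP => pG; apply: nY; apply/eqP; rewrite eqEsubset AY.
    rewrite e3 in A2; apply/subsetP => x xY; have [->//|xp] := eqVneq x p.
    by apply: (subsetP A2); rewrite !inE xp.
  by rewrite eG eqxx; left.
by do ?[case: ifP => _]; first [by right; apply: level_lt | exact: level_sub].
Qed.

Lemma position0 (n : nat) (X Y : {set 'I_n}) (m p : 'I_n) (F : {set {set 'I_n}}) :
  position X Y m p F = (0, set0) <->
  (least_with Y m F = m |: (p |: X) \/
   least_with Y m F = m |: X /\ least_with Y p F = m |: (p |: X)).
Proof.
rewrite /position; split.
  by do 4?[case: eqVneq => ?]; auto.
by case=> [->|[-> ->]]; rewrite ?eqxx //; case: ifP.
Qed.

Lemma position1 (n : nat) (X Y : {set 'I_n}) (m p : 'I_n) (B : {set 'I_n})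
    (F : {set {set 'I_n}}) :
  p \notin m |: X -> B != m |: (p |: X) ->
  position X Y m p F = (1, B) <-> least_with Y m F = m |: X /\ least_with Y p F = B.
Proof.
move=> pmX nB; rewrite /position; split.
  by do 5?[case: eqVneq => ?] => // -[].
case=> -> ->; rewrite eqxx (negPf nB); case: eqP => // e.
by case/negP: pmX; rewrite e !inE eqxx orbT.
Qed.

Lemma position2 (n : nat) (X Y : {set 'I_n}) (m p : 'I_n) (A : {set 'I_n})
    (F : {set {set 'I_n}}) :
  A != m |: (p |: X) -> A != m |: X -> A != Y -> A != Y :\ p ->
  position X Y m p F = (2, A) <-> least_with Y m F = A.
Proof.
move=> n0 n1 n2 n3; rewrite /position; split.
  by do 6?[case: eqVneq => ?] => // -[].
by move=> ->; rewrite (negPf n0) (negPf n1) (negPf n2) (negPf n3).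
Qed.

Lemma position3 (n : nat) (X Y : {set 'I_n}) (m p : 'I_n) (C : {set 'I_n})
    (F : {set {set 'I_n}}) :
  p \notin m |: X -> p \in Y -> Y != m |: (p |: X) -> C != Y :\ m ->
  position X Y m p F = (3, C) <->
  least_with Y m F = Y /\ least_with (Y :\ m) p F = C.
Proof.
move=> pmX pY nY nC; rewrite /position; split.
  by do 6?[case: eqVneq => ?] => // -[].
case=> -> ->; rewrite eqxx (negPf nC) (negPf nY); case: eqP => // e.
by case/negP: pmX; rewrite -e.
Qed.

Lemma position4 (n : nat) (X Y : {set 'I_n}) (m p : 'I_n) (F : {set {set 'I_n}}) :
  p \notin m |: X -> p \in Y -> m \in Y -> Y != m |: (p |: X) ->
  position X Y m p F = (4, set0) <->
  (least_with Y m F = Y /\ least_with (Y :\ m) p F = Y :\ m \/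
   least_with Y m F = Y :\ p).
Proof.
move=> pmX pY mY nY.
have nY1 : Y != m |: X by apply: contraNneq pmX => <-.
have nY2 : Y :\ p != m |: X.
  by apply: contra nY => /eqP e; rewrite setUCA -e setD1K.
have nY3 : Y :\ p != m |: (p |: X).
  by apply/eqP => /setP/(_ p); rewrite !inE eqxx orbT.
have nY4 : Y :\ p != Y by apply/eqP => /setP/(_ p); rewrite !inE eqxx pY.
rewrite /position; split.
  by do 6?[case: eqVneq => ?] => // _; [left | right].
case=> [[-> ->]|->]; first by rewrite (negPf nY) (negPf nY1) !eqxx.
by rewrite (negPf nY2) (negPf nY3) (negPf nY4) eqxx.
Qed.

Lemma descent_chain_nil (n : nat) (X : {set 'I_n}) : descent_chain X X set0.
Proof. by move=> B; rewrite inE. Qed.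

Lemma descent_chain_diag (n : nat) (X : {set 'I_n}) F : descent_chain X X F -> F = set0.
Proof. by move=> /descent_chain_short; apply; rewrite subnn. Qed.

Lemma least_withU1 (n : nat) (Y B : {set 'I_n}) (p : 'I_n) (F : {set {set 'I_n}}) :
  p \notin B -> least_with Y p (B |: F) = least_with Y p F.
Proof.
move=> pB; apply/setP => x; apply/in_least_with/in_least_with => -[xY h]; split=> // C.
  by move=> CF; apply: h; rewrite inE CF orbT.
by case/setU1P => [->|CF]; [rewrite (negPf pB) | apply: h].
Qed.

(** Pieces 0 and 4 are cones; the others are products of chains in shorter
    intervals. *)
Lemma morse_piece (n : nat) (X Y : {set 'I_n}) (m p : 'I_n) (t : nat * {set 'I_n}) :
  m \in Y -> m \notin X -> p \in Y -> p \notin X -> p < m -> X \subset Y ->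
  (forall z, z \in Y -> z \notin X -> z != m -> z != p -> z < p) ->
  (forall X' Y' : {set 'I_n}, X' \subset Y' -> #|Y'| - #|X'| < #|Y| - #|X| ->
     morse (@descent_chain n X' Y') (homology_range (#|Y'| - #|X'|))) ->
  morse (fun F => descent_chain X Y F /\ position X Y m p F = t)
    (homology_range (#|Y| - #|X|)).
Proof.
move=> mY mX pY pX pm XY small IH.
have mp : m != p by apply: contraTneq pm => ->; rewrite ltnn.
have mmax z : z \in Y -> z \notin X -> z != m -> z < m.
  move=> zY zX zm; have [->//|zp] := eqVneq z p.
  by apply: ltn_trans pm; apply: small.
have pmX : p \notin m |: X by rewrite !inE eq_sym (negPf mp).
have cX : #|m |: X| = #|X|.+1 by rewrite cardsU1 mX.
have mXY : m |: X \subset Y by rewrite subUset sub1set mY.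
have nmX : m |: X != Y by apply: contraNneq pmX => ->.
apply: morse_inhabited => F0 [g0 <-] {t}.
have A1 := least_with_top g0 mY XY; have B1 := least_with_top g0 pY XY.
have AY : least_with Y m F0 \subset Y by apply: subsetIl.
have BY : least_with Y p F0 \subset Y by apply: subsetIl.
have cY := subset_leq_card XY.
(* No bar after m: deleting m is a bijection. *)
have dropm F : descent_chain X Y F /\ least_with Y m F = Y <->
    descent_chain X (Y :\ m) F.
  rewrite (split_at_max F XY (subxx Y) mY mX mmax) eqxx; split.
    by case=> L [R [gL /descent_chain_diag -> ->]]; rewrite set0U setU0.
  by move=> gF; exists F, set0; rewrite set0U setU0; split=> //; apply: descent_chain_nil.
(* The singleton m as first block: deleting it is a bijection. *)
have addm F : descent_chain X Y F /\ least_with Y m F = m |: X <->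
    exists2 R, descent_chain (m |: X) Y R & F = (m |: X) |: R.
  rewrite (split_at_max F (subsetUr _ _) mXY (setU11 m X) mX mmax).
  rewrite (negPf nmX) setU1K //; split.
    by case=> L [R [/descent_chain_diag -> gR ->]]; exists R; rewrite ?set0U.
  by case=> R gR ->; exists set0, R; rewrite set0U; split=> //; apply: descent_chain_nil.
have card2 (A : {set 'I_n}) : (m |: (p |: X)) \subset A -> #|X| + 2 <= #|A|.
  have -> : #|X| + 2 = #|m |: (p |: X)|.
    by rewrite cardsU1 !inE (negPf mp) (negPf mX) cardsU1 pX addnC.
  exact: subset_leq_card.
rewrite {2}/position; case: eqVneq => [eA|nA0].
  by apply: (@morse_cone _ X Y m p) => // F; split=> -[gF h]; split=> //; apply/position0.
case: eqVneq => [eA|nA1].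
  case: eqVneq => [eB|nB].
    by apply: (@morse_cone _ X Y m p) => // F; split=> -[gF h]; split=> //; apply/position0.
  set a := least_with Y p F0 in nB B1 BY *.
  have mXF : m |: X \in F0 by rewrite -eA; apply: least_with_mem g0 _; rewrite eA.
  have mB : m |: (p |: X) \subset a.
    rewrite subUset B1 andbT sub1set; apply/in_least_with; split=> // B BF pB.
    have [_ _ cB _] := g0 B BF; case: (cB _ mXF) => [/subsetP/(_ p pB)|/subsetP/(_ m)].
      by rewrite (negPf pmX).
    by apply; apply: setU11.
  have mXa : m |: X \subset a by apply: subset_trans mB; rewrite setUS // subsetUr.
  have pa : p \in a by apply: (subsetP B1); apply: setU11.
  have small' z : z \in Y -> z \notin m |: X -> z != p -> z < p.
    by move=> zY; rewrite !inE negb_or => /andP[zm zX]; apply: small.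
  pose Za := if a == Y then set0 else [set a].
  have ZaE B : (B \in Za) = (a != Y) && (B == a).
    by rewrite /Za; case: (a == Y); rewrite !inE.
  have ca : #|X| + 3 <= #|a|.
    have : #|m |: (p |: X)| < #|a| by apply: proper_card; rewrite properEneq eq_sym nB.
    by have := card2 _ (subxx (m |: (p |: X))); rewrite addn2 addn3; apply: leq_ltn_trans.
  have cap : #|a :\ p| = #|a|.-1 by rewrite (cardsD1 p a) pa.
  have caY := subset_leq_card BY.
  apply: (@morse_split _ (m |: X) (a :\ p) a Y _ (m |: X |: Za) _
    (homology_range (#|a :\ p| - #|m |: X|)) (homology_range (#|Y| - #|a|))) => //.
  + exact: subD1set.
  + move=> B; rewrite !inE ZaE => /orP[/eqP->|/andP[_ /eqP->]]; first by left.
    by right; left; rewrite subD1set.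
  + by rewrite subsetD1 mXa.
  + move=> F; rewrite (position1 _ F pmX nB).
    have spl R := split_at_max R mXa BY pa pmX small'.
    split=> [[gF [h1 h2]]|[L [R [gL gR ->]]]].
      have /addm[R gR eF] := conj gF h1.
      have : descent_chain (m |: X) Y R /\ least_with Y p R = a.
        by split=> //; rewrite -h2 eF least_withU1.
      by case/spl => L [R' [gL gR' eR]]; exists L, R'; split=> //; rewrite eF eR; exact: setUA.
    have /spl[gR' eR'] : exists L' R', [/\ descent_chain (m |: X) (a :\ p) L',
        descent_chain a Y R' & Za :|: (L :|: R) = Za :|: (L' :|: R')].
      by exists L, R.
    have /addm[gF e1] : exists2 R', descent_chain (m |: X) Y R' &
        (m |: X) |: Za :|: (L :|: R) = (m |: X) |: R'.
      exists (Za :|: (L :|: R)); [exact: gR' | exact/esym/setUA].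
    by do !split=> //; rewrite -setUA least_withU1.
  + have cZ : #|m |: X |: Za| = (a != Y).+1.
      rewrite cardsU1 ZaE negb_and; have -> : m |: X != a.
        by apply/eqP => e; move: ca; rewrite -e cX; clear; lia.
      by rewrite orbT /Za; case: (a == Y); rewrite ?cards0 ?cards1.
    rewrite cZ cap cX => d1 d2; apply: range_m_Up_V ca caY _ _.
      by move=> naY; apply: proper_card; rewrite properEneq naY.
    by rewrite negbK => /eqP ->.
  + by apply: IH; [rewrite subsetD1 mXa | rewrite cap cX; clear -ca caY; lia].
  + by apply: IH => //; clear -ca caY; lia.
case: eqVneq => [eA|nA2].
  have nY : Y != m |: (p |: X) by rewrite -eA.
  case: eqVneq => [eC|nC].
    apply: (@morse_cocone _ X Y m p) => // F.
    have P4 := position4 F pmX pY mY nY.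
    by split=> -[gF h]; split=> //; apply/P4.
  have pYm : p \in Y :\ m by rewrite !inE eq_sym mp.
  have XYm : X \subset Y :\ m by rewrite subsetD1 XY.
  have C1 := least_with_top ((dropm F0).1 (conj g0 eA)) pYm XYm.
  set c := least_with (Y :\ m) p F0 in nC C1 *.
  have CY : c \subset Y :\ m by apply: subsetIl.
  have Xc : X \subset c by apply: subset_trans C1; apply: subsetUr.
  have pc : p \in c by apply: (subsetP C1); apply: setU11.
  have small' z : z \in Y :\ m -> z \notin X -> z != p -> z < p.
    by rewrite !inE => /andP[zm zY] zX; apply: small.
  have ccp : #|c :\ p| = #|c|.-1 by rewrite (cardsD1 p c) pc.
  have cc : #|X| < #|c| by have := subset_leq_card C1; rewrite cardsU1 pX.
  have cYm : #|Y :\ m| = #|Y|.-1 by rewrite (cardsD1 m Y) mY.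
  have ccY : #|c| < #|Y :\ m| by apply: proper_card; rewrite properEneq nC.
  apply: (@morse_split _ X (c :\ p) c (Y :\ m) _ [set c] _
    (homology_range (#|c :\ p| - #|X|)) (homology_range (#|Y :\ m| - #|c|))) => //.
  + exact: subD1set.
  + by move=> B; rewrite !inE => /eqP->; right; left; rewrite subD1set.
  + by rewrite subsetD1 Xc.
  + move=> F; rewrite (position3 F pmX pY nY nC).
    have := split_at_max F Xc CY pc pX small'; rewrite (negPf nC) => <-.
    by split=> [[gF [h1 h2]]|[gF h]]; [split=> //; apply/dropm | have /dropm[] := gF].
  + by rewrite cards1 ccp cYm => d1 d2; apply: range_Up_Vm => //; rewrite -cYm.
  + by apply: IH; [rewrite subsetD1 Xc | rewrite ccp; clear -cc ccY cYm; lia].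
  + by apply: IH => //; rewrite cYm in ccY *; clear -cc ccY; lia.
case: eqVneq => [eA|nA3].
  have nY : Y != m |: (p |: X).
    apply: contra nA1 => /eqP eY; rewrite eA {1}eY setUCA setU1K // .
  apply: (@morse_cocone _ X Y m p) => // F.
  have P4 := position4 F pmX pY mY nY.
  by split=> -[gF h]; split=> //; apply/P4.
set A := least_with Y m F0 in nA0 nA1 nA2 nA3 A1 AY *.
have mA : m \in A by apply: (subsetP A1); apply: setU11.
have XA : X \subset A by apply: subset_trans A1; apply: subsetUr.
have cA : #|m |: X| < #|A| by apply: proper_card; rewrite properEneq eq_sym nA1.
have cAm : #|A :\ m| = #|A|.-1 by rewrite (cardsD1 m A) mA.
have cAY : #|A| < #|Y| by apply: proper_card; rewrite properEneq nA2.
apply: (@morse_split _ X (A :\ m) A Y _ [set A] _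
  (homology_range (#|A :\ m| - #|X|)) (homology_range (#|Y| - #|A|))) => //.
- exact: subD1set.
- by move=> B; rewrite !inE => /eqP->; right; left; rewrite subD1set.
- by rewrite subsetD1 XA.
- move=> F; rewrite (position2 F nA0 nA1 nA2 nA3).
  by have := split_at_max F XA AY mA mX mmax; rewrite (negPf nA2).
- by rewrite cards1 cAm => d1 d2; apply: range_Um_V => //; rewrite -cX.
- by apply: IH; [rewrite subsetD1 XA | rewrite cX in cA; rewrite cAm; clear -cA cAY; lia].
- by apply: IH => //; rewrite cX in cA; clear -cA cAY; lia.
Qed.

(** Induction on the number of letters: the faces are filtered by [position] for
    the two largest letters.  With at most one letter the only face is empty. *)
Lemma morse_descent_chain (n : nat) (X Y : {set 'I_n}) :
  X \subset Y -> morse (@descent_chain n X Y) (homology_range (#|Y| - #|X|)).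
Proof.
have [s] := ubnP (#|Y| - #|X|); elim: s X Y => // s IH X Y le_s XY.
have [le1|gt1] := leqP (#|Y| - #|X|) 1.
  apply: (morse_weaken _ _ (morse_point (K := descent_chain X Y) _)) => // [d ->|F].
    by rewrite /homology_range; lia.
  by move=> gF; apply: descent_chain_short gF le1.
have cYX : #|Y :\: X| = #|Y| - #|X| by rewrite cardsD (setIidPr XY).
have /card_gt0P[m0 m0YX] : 0 < #|Y :\: X| by rewrite cYX; lia.
case: (@arg_maxnP _ m0 (mem (Y :\: X)) (@nat_of_ord n) m0YX) => m mYX mmax.
have {}mYX : m \in Y :\: X := mYX.
have /card_gt0P[p0 p0YX] : 0 < #|(Y :\: X) :\ m|.
  by move: gt1; rewrite -cYX (cardsD1 m) mYX.
case: (@arg_maxnP _ p0 (mem ((Y :\: X) :\ m)) (@nat_of_ord n) p0YX) => p pYX pmax.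
have {}pYX : p \in (Y :\: X) :\ m := pYX.
move: mYX pYX; rewrite !inE => /andP[mX mY] /and3P[pm pX pY].
have plt : p < m.
  by rewrite ltn_neqAle pm /=; apply: mmax; rewrite /= !inE pX.
apply: (@morse_filter _ _ _ _ (position X Y m p) (@level n)) => [F G gF gG GF|t].
  exact: position_mono gF GF.
apply: morse_piece => // [z zY zX zm zp|X' Y' XY' lt].
  by rewrite ltn_neqAle zp /=; apply: pmax; rewrite /= !inE zm zX.
by apply: IH => //; apply: leq_trans lt _.
Qed.

(** * Cycles detected by facets *)

Local Open Scope ring_scope.

(** The join of the vertex [v] with the chain [f], i.e. exterior multiplication
    by [v]. *)
Definition cone (V : finType) (v : V) (f : {set V} -> int) (F : {set V}) : int :=
  if v \in F then (-1) ^+ vertex_pos F v * f (F :\ v) else 0.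

Lemma cone_neq0 (V : finType) (v : V) (f : {set V} -> int) (F : {set V}) :
  cone v f F != 0 -> v \in F /\ f (F :\ v) != 0.
Proof.
by rewrite /cone; case: ifP => [vF|_ /eqP//]; rewrite mulf_eq0 negb_or => /andP[].
Qed.

Lemma cone_U1_neq0 (V : finType) (v : V) (f : {set V} -> int) (F : {set V}) :
  v \notin F -> f F != 0 -> cone v f (v |: F) != 0.
Proof. by move=> vF fF; rewrite /cone setU11 setU1K // mulf_neq0 // signr_eq0. Qed.

Lemma full_bd_cone (V : finType) (v : V) (f : {set V} -> int) (G : {set V}) :
  full_bd (cone v f) G = f G - cone v (full_bd f) G.
Proof.
rewrite /full_bd /cone; case: ifP => vG.
  rewrite [X in _ = _ - _ * X](bigD1 v) /=; last by rewrite !inE eqxx.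
  rewrite setD1K // mulrDr mulrA -expr2 sqrr_sign mul1r opprD addrA subrr add0r.
  rewrite mulr_sumr -sumrN.
  have e w : (w \notin G :\ v) && (w != v) = (w \notin G).
    by rewrite !inE; have [->|_] := eqVneq w v; rewrite ?vG ?andbT.
  rewrite [RHS](eq_bigl (fun w => w \notin G)) //; apply: eq_bigr => w wG.
  have wv : v != w by apply: contraNneq wG => <-.
  rewrite !inE vG orbT; have -> : (w |: G) :\ v = w |: G :\ v.
    by apply/setP => x; rewrite !inE; case: (eqVneq x v) => // ->; rewrite (negPf wv).
  rewrite !mulrA -mulNr; congr (_ * _).
  have := @vertex_pos_swap _ (G :\ v) v w wv.
  rewrite !inE eqxx (negPf wG) andbF [v |: (w |: _)]setUCA !setD1K // => /(_ isT isT) e4.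
  have sq (H : {set V}) x : (-1) ^+ vertex_pos H x * (-1) ^+ vertex_pos H x = 1 :> int.
    by rewrite -expr2 sqrr_sign.
  move: e4 (sq G v) (sq (w |: G) v); set a := _ ^+ _; set b := _ ^+ vertex_pos G v.
  set c := _ ^+ vertex_pos (w |: G) v; set q := _ ^+ vertex_pos _ _ => e4 bb cc.
  rewrite -mulNr; transitivity ((a * b) * (c * b)); first by rewrite mulrACA bb mulr1.
  by rewrite e4 mulNr mulrACA cc mul1r mulrC -mulNr.
rewrite subr0 (bigD1 v) ?vG //= setU11 setU1K ?vG // mulrA -expr2 sqrr_sign mul1r.
rewrite big1 ?addr0 // => w /andP[wG wv].
by rewrite !inE vG orbF eq_sym (negPf wv) mulr0.
Qed.

Lemma full_bdD (V : finType) (f g : {set V} -> int) (G : {set V}) :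
  full_bd (fun F => f F + g F) G = full_bd f G + full_bd g G.
Proof. by rewrite /full_bd -big_split; apply: eq_bigr => v _; rewrite mulrDr. Qed.

Lemma full_bdB (V : finType) (f g : {set V} -> int) (G : {set V}) :
  full_bd (fun F => f F - g F) G = full_bd f G - full_bd g G.
Proof. by rewrite /full_bd -sumrB; apply: eq_bigr => v _; rewrite mulrBr. Qed.

Lemma full_bd_cone_cycle (V : finType) (v : V) (f : {set V} -> int) (G : {set V}) :
  (forall G', full_bd f G' = 0) -> full_bd (cone v f) G = f G.
Proof.
move=> zf; rewrite full_bd_cone /cone; case: ifP => _; last by rewrite subr0.
by rewrite zf mulr0 subr0.
Qed.

Lemma full_bd_cone2 (V : finType) (v w : V) (f : {set V} -> int) (G : {set V}) :
  (forall G', full_bd f G' = 0) ->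
  full_bd (cone v (cone w f)) G = cone w f G - cone v f G.
Proof.
move=> zf; rewrite full_bd_cone; congr (_ - _); rewrite /cone; case: ifP => // _.
by rewrite -/(cone w f) full_bd_cone_cycle.
Qed.

Lemma descent_chain_widen (n : nat) (X Y Y' : {set 'I_n}) (F : {set {set 'I_n}}) :
  Y \subset Y' -> descent_chain X Y F -> descent_chain X Y' F.
Proof.
move=> YY gF B BF; have [XB BY cB [x [y [xB yB lt sep]]]] := gF B BF.
split=> //; first exact: subset_trans YY; exists x, y; split=> //.
by move: yB; rewrite !inE => /andP[-> /(subsetP YY)].
Qed.

Lemma descent_chain_add (n : nat) (X Y B : {set 'I_n}) (x y : 'I_n)
    (F : {set {set 'I_n}}) :
  descent_chain X B F -> X \subset B -> B \subset Y ->
  x \in B :\: X -> y \in Y :\: B -> (y < x)%N -> (forall C, C \in F -> x \notin C) ->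
  descent_chain X Y (B |: F).
Proof.
move=> gF XB BY xB yB lt xF C /setU1P[->|CF].
  split=> // [C' /setU1P[->|/gF[]]|]; [by left | by right |].
  exists x, y; split=> // C' /setU1P[->|C'F]; first by split.
  by rewrite (negPf (xF _ C'F)); split=> // _; have [] := gF _ C'F.
have [XC CB cC [x' [y' [x'C y'C lt' sep]]]] := gF C CF.
split=> // [|C' /setU1P[->|/cC//]|]; [exact: subset_trans BY | by left |].
move: (y'C); rewrite inE => /andP[y'nC y'B].
exists x', y'; split=> //; first by rewrite inE y'nC (subsetP BY).
by move=> C' /setU1P[->|/sep//]; rewrite y'B.
Qed.

Lemma descent_chain_restrict (n : nat) (X Y W : {set 'I_n}) (F G : {set {set 'I_n}}) :
  descent_chain X Y G -> W \in G -> F \subset G -> (forall C, C \in F -> C \proper W) ->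
  descent_chain X W F.
Proof.
move=> gG WG /subsetP FG FW C CF.
have [XC CY cC [x [y [xC yC lt sep]]]] := gG C (FG C CF).
split=> // [|C' /FG/cC//|]; first exact: proper_sub (FW C CF).
exists x, y; split=> //; last by move=> C' /FG/sep.
move: yC; rewrite !inE => /andP[-> _] /=; apply/negPn/negP => /(proj2 (sep W WG)).
by have := FW C CF; rewrite properE => /andP[_ /negPf ->].
Qed.

(** A cycle [z] of faces with [d] bars on the letters of [W] that is nonzero at
    a facet [F]. *)
Definition detected_cycle (n : nat) (W : {set 'I_n}) (d : nat) : Prop :=
  exists (z : {set {set 'I_n}} -> int) (F : {set {set 'I_n}}),
  [/\ forall G, full_bd z G = 0,
      forall G, z G != 0 -> descent_chain set0 W G /\ #|G| = d,
      z F != 0 &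
      forall B, descent_chain set0 W (B |: F) -> B \in F].

Lemma detected_point (n : nat) (w : 'I_n) : detected_cycle [set w] 0.
Proof.
exists (fun F => (F == set0)%:R), set0; split=> [G|G||B gB].
- rewrite /full_bd big1 // => v _; case: eqP => [/setP/(_ v)|_]; last by rewrite mulr0.
  by rewrite setU11 inE.
- have [-> _|_] := eqVneq G set0; last by rewrite eqxx.
  by rewrite cards0; split=> // B; rewrite inE.
- by rewrite eqxx.
have := descent_chain_short gB; rewrite cards1 cards0 => /(_ isT)/setP/(_ B).
by rewrite setU11 inE.
Qed.

(** The join of [z] with the difference of the vertices [b |: W] and [W], i.e.
    the cycle z b | a - z | a b.  The facet is F | a b: in the block a b, the
    largest letter b cannot come right after a bar as a singleton, and splitting a
    block of F inside F | a b would split it inside F. *)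
Lemma detected_outer (n : nat) (W : {set 'I_n}) (a b : 'I_n) (d : nat) :
  W != set0 -> (forall w, w \in W -> (a < w)%N /\ (w < b)%N) -> (a < b)%N ->
  detected_cycle W d -> detected_cycle (a |: (b |: W)) d.+1.
Proof.
move=> W0 hW ab [z [F [zz zs zF facF]]].
have aW : a \notin W by apply/negP => /hW[]; rewrite ltnn.
have bW : b \notin W by apply/negP => /hW[_]; rewrite ltnn.
have nab : a != b by apply: contraTneq ab => ->; rewrite ltnn.
pose Y := a |: (b |: W); pose Wb := b |: W.
have WY : W \subset Y by rewrite /Y setUA subsetUr.
have WbY : Wb \subset Y by rewrite /Y subsetUr.
have W0p : set0 \proper W by rewrite properEneq eq_sym W0 sub0set.
have [gF cF] := zs F zF.
have below G B : descent_chain set0 W G -> B \in G -> B \proper W.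
  by move=> /descent_chain_open/subsetP h /h; rewrite inE => /andP[].
have WF G : descent_chain set0 W G -> W \notin G.
  by move=> gG; apply/negP => /(below G _ gG); rewrite properxx.
have nWb : Wb != W by apply: contraNneq bW => <-; apply: setU11.
exists (fun G => cone Wb z G - cone W z G), (W |: F); split=> [G|G||B gB].
- by rewrite full_bdB !full_bd_cone_cycle // subrr.
- have [->|h _] := eqVneq (cone Wb z G) 0.
    rewrite sub0r oppr_eq0 => /cone_neq0[WG /zs[gG <-]].
    rewrite (cardsD1 W G) WG; split=> //; rewrite -(setD1K WG).
    have [x xW xG] := descent_chain_last gG W0p.
    move: (xW); rewrite inE => /andP[_ /hW[ax _]].
    by apply: (@descent_chain_add _ _ _ _ x a) => //; rewrite ?sub0set // !inE ?eqxx ?aW.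
  have [WG /zs[gG <-]] := cone_neq0 h.
  rewrite (cardsD1 Wb G) WG; split=> //; rewrite -(setD1K WG).
  apply: (@descent_chain_add _ _ _ _ b a) => //; rewrite ?sub0set // ?inE ?eqxx //.
  - by apply: descent_chain_widen gG; apply: subsetUr.
  - by rewrite (negPf nab) (negPf aW).
  - by move=> C /(below _ _ gG)/proper_sub/subsetP CW; apply: contra bW; apply: CW.
- have WbF : Wb \notin W |: F.
    rewrite !inE negb_or nWb; apply/negP => /(below F _ gF)/proper_sub/subsetP/(_ b).
    by rewrite setU11 (negPf bW) => /(_ isT).
  rewrite {1}/cone (negPf WbF) sub0r oppr_eq0.
  by apply: cone_U1_neq0 => //; apply: WF.
apply/setU1P; have [->|nBW] := eqVneq B W; [by left | right].
have WG : W \in B |: (W |: F) by rewrite !inE eqxx orbT.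
have [_ BY cB [x [y [xB yB lt sep]]]] := gB B (setU11 _ _).
case: (cB W WG) => [BW|WB].
  apply: facF; apply: descent_chain_restrict gB WG _ _.
    by apply: setUS; apply: subsetUr.
  by move=> C /setU1P[->|/(below _ _ gF)//]; rewrite properEneq nBW.
exfalso; have [_ _ _ [x1 [y1 [x1W y1W lt1 sep1]]]] := gB W WG.
move: x1W y1W; rewrite !inE => /andP[_ /hW[ax1 x1b]] /andP[y1W /or3P[/eqP ey1|/eqP ey1|y1W']]; last first.
- by rewrite y1W' in y1W.
- by move: lt1; rewrite ey1 => /(ltn_trans x1b); rewrite ltnn.
have aB : a \in B.
  rewrite -ey1; apply/negPn/negP => /(proj2 (sep1 B (setU11 _ _))) BW.
  by case/negP: nBW; rewrite eqEsubset BW.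
have xW : x \notin W.
  apply/negP => /(proj1 (sep W WG)) BW.
  by case/negP: nBW; rewrite eqEsubset BW.
move: yB; rewrite !inE => /andP[yB /or3P[/eqP eya|/eqP eyb|yW]].
- by move: yB; rewrite eya aB.
- move: xB; rewrite !inE => /andP[_ xB]; have := subsetP BY x xB.
  rewrite !inE (negPf xW) orbF => /orP[]/eqP ex; move: lt; rewrite eyb ex; first by rewrite ltnNge ltnW.
  by rewrite ltnn.
- by move: yB; rewrite (subsetP WB).
Qed.

(** The join of [z] with the difference of the vertices [b |: W] and [c |: W],
    i.e. the cycle z b | a c - z c | a b.  The facet is F b | a c: neither c nor a
    can be split off the last block, and if the last block of F b is split, then
    its second part contains b, the only letter of F b that exceeds a, and
    deleting b gives a split of F. *)
Lemma detected_upper (n : nat) (W : {set 'I_n}) (a b c : 'I_n) (d : nat) :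
  W != set0 -> (forall w, w \in W -> (w < a)%N) -> (a < b)%N -> (b < c)%N ->
  detected_cycle W d -> detected_cycle (a |: (b |: (c |: W))) d.+1.
Proof.
move=> W0 hW ab bc [z [F [zz zs zF facF]]].
have ac := ltn_trans ab bc.
have aW : a \notin W by apply/negP => /hW; rewrite ltnn.
have bW : b \notin W by apply/negP => /hW /ltn_trans/(_ ab); rewrite ltnn.
have cW : c \notin W by apply/negP => /hW /ltn_trans/(_ ac); rewrite ltnn.
have nab : a != b by apply: contraTneq ab => ->; rewrite ltnn.
have nac : a != c by apply: contraTneq ac => ->; rewrite ltnn.
have nbc : b != c by apply: contraTneq bc => ->; rewrite ltnn.
pose Y := a |: (b |: (c |: W)); pose Wb := b |: W; pose Wc := c |: W.
have WbY : Wb \subset Y by rewrite /Y setUCA setUS // setUA subsetUr.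
have WcY : Wc \subset Y by rewrite /Y setUA subsetUr.
have [gF cF] := zs F zF.
have below G B : descent_chain set0 W G -> B \in G -> B \proper W.
  by move=> /descent_chain_open/subsetP h /h; rewrite inE => /andP[].
have outside G B v : descent_chain set0 W G -> B \in G -> v \notin W -> v \notin B.
  by move=> gG /(below _ _ gG)/proper_sub/subsetP BW; apply: contra; apply: BW.
have nF v : v \notin W -> v |: W \notin F.
  by move=> vW; apply/negP => /(outside _ _ _ gF)/(_ vW); rewrite setU11.
have supp G v : v \in [set b; c] -> cone (v |: W) z G != 0 ->
    descent_chain set0 Y G /\ #|G| = d.+1.
  move=> vbc /cone_neq0[vG /zs[gG <-]]; rewrite (cardsD1 (v |: W) G) vG; split=> //.
  have vW : v \notin W by case/set2P: vbc => ->.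
  have av : (a < v)%N by case/set2P: vbc => ->.
  rewrite -(setD1K vG); apply: (@descent_chain_add _ _ _ _ v a) => //.
  - by apply: descent_chain_widen gG; apply: subsetUr.
  - exact: sub0set.
  - by case/set2P: vbc => ->.
  - by rewrite !inE eqxx.
  - by rewrite !inE eqxx (negPf aW) orbF andbT; case/set2P: vbc => ->.
  - by move=> C CG; apply: outside gG CG vW.
exists (fun G => cone Wb z G - cone Wc z G), (Wb |: F); split=> [G|G||B gB].
- by rewrite full_bdB !full_bd_cone_cycle // subrr.
- have [->|h _] := eqVneq (cone Wb z G) 0; last by apply: supp h; rewrite !inE eqxx.
  by rewrite sub0r oppr_eq0; apply: supp; rewrite !inE eqxx orbT.
- have WcF : Wc \notin Wb |: F.
    rewrite inE negb_or nF // andbT inE; apply/eqP => /setP/(_ c).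
    by rewrite !inE eqxx eq_sym (negPf nbc) (negPf cW).
  by rewrite [X in _ - X]/cone (negPf WcF) subr0; apply: cone_U1_neq0 => //; apply: nF.
apply/setU1P; have [->|nB] := eqVneq B Wb; [by left | right].
have WG : Wb \in B |: (Wb |: F) by rewrite !inE eqxx orbT.
have [_ BY cB [x [y [xB yB lt sep]]]] := gB B (setU11 _ _).
have [_ _ _ [x1 [y1 [x1W y1W lt1 sep1]]]] := gB Wb WG.
have ey1 : y1 = a.
  move: x1W y1W; rewrite !inE => /andP[_ x1W] /andP[y1W /or4P[/eqP//|/eqP ey|/eqP ey|y1W']].
  - by rewrite ey eqxx in y1W.
  - move: lt1; rewrite ey => lt1; case/orP: x1W => [/eqP e|/hW x1a].
      by rewrite e in lt1; have := ltn_trans bc lt1; rewrite ltnn.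
    by move: (ltn_trans lt1 (ltn_trans x1a ac)); rewrite ltnn.
  - by rewrite y1W' orbT in y1W.
have ex1 : x1 = b.
  move: x1W; rewrite !inE => /andP[_ /orP[/eqP//|/hW x1a]].
  by move: (ltn_trans lt1 x1a); rewrite ey1 ltnn.
case: (cB Wb WG) => [BW|WB]; last first.
  exfalso; have BW : ~~ (B \subset Wb).
    by apply: contra nB => BW; rewrite eqEsubset BW.
  have aB : a \in B.
    by rewrite -ey1; apply/negPn/negP => /(proj2 (sep1 B (setU11 _ _))); apply/negP.
  have xW : x \notin Wb by apply: contra BW; apply: (proj1 (sep Wb WG)).
  move: xB yB xW; rewrite !inE negb_or => /andP[_ xB] /andP[yB yY] /andP[xb xW].
  have := subsetP BY x xB; rewrite !inE (negPf xb) (negPf xW) orbF /=.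
  have bB : b \in B by apply: (subsetP WB); rewrite !inE eqxx.
  case/or4P: yY => [/eqP ey|/eqP ey|/eqP ey|yW].
  - by rewrite ey aB in yB.
  - by rewrite ey bB in yB.
  - case/orP => /eqP ex; move: lt; rewrite ex ey ?ltnn //.
    by move=> /(ltn_trans ac); rewrite ltnn.
  - by rewrite (subsetP WB) ?inE ?yW ?orbT in yB.
have bB : b \notin B.
  rewrite -ex1; apply: contra nB => /(proj1 (sep1 B (setU11 _ _))) WB.
  by rewrite eqEsubset BW.
have {}BW : B \subset W.
  by apply/subsetP => v vB; have /setU1P[e|//] := subsetP BW v vB; rewrite -e vB in bB.
have low (C : {set 'I_n}) x' y' : C \subset W -> x' \in C -> y' \in Y -> (y' < x')%N ->
    (y' \notin Wb -> Wb \subset C) -> y' \in W.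
  move=> /subsetP CW /CW/hW x'a y'Y lt'; case: (boolP (y' \in Wb)) => [|_ /(_ isT) WC].
    rewrite !inE => /orP[/eqP e _|//].
    by move: (ltn_trans lt' (ltn_trans x'a ab)); rewrite e ltnn.
  by case/negP: bW; apply/CW/(subsetP WC)/setU11.
have nBW : B != W.
  apply/eqP => eB; move: xB yB; rewrite !inE eB => /andP[_ xB] /andP[yB yY].
  case/negP: yB; apply: (low B x y) => //; rewrite ?eB //; first by rewrite !inE.
  by move=> h; rewrite -eB; apply: (proj2 (sep Wb WG)).
apply: facF => C CG.
have CG' : C \in B |: (Wb |: F).
  by case/setU1P: CG => [->|CF]; rewrite !inE ?eqxx ?CF ?orbT.
have CW : C \subset W by case/setU1P: CG => [->//|/(below _ _ gF)/proper_sub].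
have sub : B |: F \subset B |: (Wb |: F) by apply: setUS; apply: subsetUr.
have [_ _ cC [x' [y' [x'C y'C lt' sep']]]] := gB C CG'.
split=> [//||C' /(subsetP sub)/cC//|]; rewrite ?sub0set //.
exists x', y'; split=> //; last by move=> C' /(subsetP sub)/sep'.
move: x'C y'C; rewrite !inE => /andP[_ x'C] /andP[-> y'Y] /=.
by apply: (low C x' y') => //; [rewrite !inE | apply: (proj2 (sep' Wb WG))].
Qed.

(** The join of [z] with the boundary of the triangle on [W], [b |: W] and
    [c |: (b |: W)], i.e. the cycle z | b | a c - z | b c | a + z b | c | a.  The
    facet is F | b | a c: the block a c cannot be split, since c cannot follow a
    bar right after a or b, and a split of a block of F would be one inside F. *)
Lemma detected_lower (n : nat) (W : {set 'I_n}) (a b c : 'I_n) (d : nat) :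
  W != set0 -> (forall w, w \in W -> (c < w)%N) -> (a < b)%N -> (b < c)%N ->
  detected_cycle W d -> detected_cycle (a |: (b |: (c |: W))) d.+2.
Proof.
move=> W0 hW ab bc [z [F [zz zs zF facF]]].
have ac := ltn_trans ab bc.
have cW : c \notin W by apply/negP => /hW; rewrite ltnn.
have bW : b \notin W by apply/negP => /hW /(ltn_trans bc); rewrite ltnn.
have aW : a \notin W by apply/negP => /hW /(ltn_trans ac); rewrite ltnn.
have nab : a != b by apply: contraTneq ab => ->; rewrite ltnn.
have nac : a != c by apply: contraTneq ac => ->; rewrite ltnn.
have nbc : b != c by apply: contraTneq bc => ->; rewrite ltnn.
pose Y := a |: (b |: (c |: W)); pose Wb := b |: W; pose Wbc := c |: Wb.
have W0p : set0 \proper W by rewrite properEneq eq_sym W0 sub0set.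
have WWb : W \subset Wb by apply: subsetUr.
have WbW : Wb \subset Wbc by apply: subsetUr.
have WbcY : Wbc \subset Y by rewrite /Y /Wbc /Wb [c |: _]setUCA subsetUr.
have WWbc := subset_trans WWb WbW; have WbY := subset_trans WbW WbcY.
have aWbc : a \notin Wbc by rewrite !inE negb_or nac negb_or nab.
have cWb : c \notin Wb by rewrite !inE negb_or eq_sym nbc.
have aWb : a \notin Wb by rewrite !inE negb_or nab.
have aY : a \in Y by apply: setU11.
have [gF cF] := zs F zF.
have below G B : descent_chain set0 W G -> B \in G -> B \proper W.
  by move=> /descent_chain_open/subsetP h /h; rewrite inE => /andP[].
have outside G B v : descent_chain set0 W G -> B \in G -> v \notin W -> v \notin B.
  by move=> gG /(below _ _ gG)/proper_sub/subsetP BW; apply: contra; apply: BW.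
have WF G : descent_chain set0 W G -> W \notin G.
  by move=> gG; apply/negP => /(below G _ gG); rewrite properxx.
have nWb : Wb != W by apply: contraNneq bW => <-; apply: setU11.
have nWbc : Wbc != Wb by apply: contraNneq cWb => <-; apply: setU11.
have nWbc2 : Wbc != W by apply: contraNneq cW => <-; apply: setU11.
have pWWb : W \proper Wb by rewrite properEneq eq_sym nWb.
have pWWbc : W \proper Wbc by rewrite properEneq eq_sym nWbc2.
have pWbWbc : Wb \proper Wbc by rewrite properEneq eq_sym nWbc.
have add2 (G : {set {set 'I_n}}) (A B : {set 'I_n}) x : descent_chain set0 W G -> W \subset A -> A \proper B -> B \subset Y ->
    a \notin B -> x \in B :\: A -> (a < x)%N ->
    (exists x' y', [/\ x' \in A, (forall C, C \in G -> x' \notin C), y' \in B :\: A &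
       (y' < x')%N]) ->
    descent_chain set0 Y (B |: (A |: G)).
  move=> gG WA AB BY aB xBA ax [x' [y' [x'A x'G y'B lt]]].
  have AsB := proper_sub AB; move: (xBA); rewrite inE => /andP[xA xB].
  apply: (@descent_chain_add _ _ _ _ x a) => //; rewrite ?sub0set // ?inE ?xB ?aB ?inE ?eqxx //.
    apply: (@descent_chain_add _ _ _ _ x' y') => //; rewrite ?sub0set // ?inE ?x'A //.
    exact: descent_chain_widen gG.
  move=> C /setU1P[->//|CG]; apply: contra xA; apply/subsetP.
  exact: subset_trans (proper_sub (below _ _ gG CG)) WA.
have supp (G : {set {set 'I_n}}) (A B : {set 'I_n}) : (A, B) \in [:: (W, Wb); (W, Wbc); (Wb, Wbc)] ->
    cone A (cone B z) G != 0 -> descent_chain set0 Y G /\ #|G| = d.+2.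
  move=> AB /cone_neq0[AG /cone_neq0[BG /zs[gG <-]]].
  have eG : G = B |: (A |: (G :\ A :\ B)).
    by rewrite setUCA setD1K // setD1K.
  rewrite (cardsD1 A G) AG (cardsD1 B (G :\ A)) BG; split=> //; rewrite eG.
  have [x xW xG] := descent_chain_last gG W0p.
  move: (xW); rewrite inE => /andP[_ xW'].
  have [xa xb] : (a < x)%N /\ (b < x)%N.
    by split; [apply: ltn_trans (hW x xW') | apply: ltn_trans (hW x xW')].
  move: AB gG xG; rewrite !inE => /or3P[]/eqP[-> ->] gG xG.
  - apply: (@add2 _ _ _ b) => //.
      by rewrite !inE eqxx bW.
    by exists x, b; rewrite !inE eqxx bW.
  - apply: (@add2 _ _ _ b) => //.
      by rewrite !inE eqxx bW orbT.
    by exists x, b; rewrite !inE eqxx bW orbT.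
  - apply: (@add2 _ _ _ c) => //.
      by rewrite inE cWb setU11.
    exists x, c; split=> //; last exact: hW.
      exact: (subsetP WWb).
    by rewrite inE cWb setU11.
exists (fun G => cone W (cone Wb z) G - cone W (cone Wbc z) G + cone Wb (cone Wbc z) G),
  (Wb |: (W |: F)).
have WbF : Wb \notin F.
  by apply/negP => /(outside _ _ b gF)/(_ bW); rewrite setU11.
have WbcF : Wbc \notin Wb |: (W |: F).
  rewrite !inE (negPf nWbc) (negPf nWbc2) /=.
  by apply/negP => /(outside _ _ c gF)/(_ cW); rewrite setU11.
split=> [G|G||B gB].
- by rewrite full_bdD full_bdB !full_bd_cone2 //; ring.
- have [h1|h1 _] := eqVneq (cone W (cone Wb z) G) 0; last first.
    by apply: (supp G W Wb) h1; rewrite !inE eqxx.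
  have [h2|h2 _] := eqVneq (cone W (cone Wbc z) G) 0; last first.
    by apply: (supp G W Wbc) h2; rewrite !inE eqxx orbT.
  by rewrite h1 h2 subr0 add0r; apply: supp; rewrite !inE eqxx !orbT.
- have cone0 A : Wbc != A -> cone A (cone Wbc z) (Wb |: (W |: F)) = 0.
    move=> nA; rewrite /cone; case: ifP => // _; rewrite inE (negPf WbcF) andbF.
    by rewrite mulr0.
  rewrite !cone0 // subr0 addr0 [Wb |: _]setUCA; apply: cone_U1_neq0.
    by rewrite !inE negb_or eq_sym nWb WF.
  exact: cone_U1_neq0.
have WG : W \in B |: (Wb |: (W |: F)) by rewrite !inE eqxx !orbT.
have WbG : Wb \in B |: (Wb |: (W |: F)) by rewrite !inE eqxx !orbT.
have [_ BY cB [x [y [xB yB lt sep]]]] := gB B (setU11 _ _).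
have [->|nBWb] := eqVneq B Wb; first exact: setU11.
have [->|nBW] := eqVneq B W; first by rewrite !inE eqxx orbT.
case: (cB W WG) => [BW|WB].
  rewrite !inE facF ?orbT //; apply: descent_chain_restrict gB WG _ _.
    by rewrite setUS // setUA subsetUr.
  by move=> C /setU1P[->|/(below _ _ gF)//]; rewrite properEneq nBW.
exfalso; case: (cB Wb WbG) => [BWb|WbB].
  case: (boolP (b \in B)) => bB.
    by case/negP: nBWb; rewrite eqEsubset BWb subUset sub1set bB.
  case/negP: nBW; rewrite eqEsubset WB andbT; apply/subsetP => v vB.
  by have /setU1P[e|//] := subsetP BWb v vB; rewrite -e vB in bB.
have [_ _ _ [x1 [y1 [x1W y1W lt1 sep1]]]] := gB Wb WbG.
have nBsub : ~~ (B \subset Wb) by apply: contra nBWb => BWb; rewrite eqEsubset BWb.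
have x1b : x1 = b.
  move: x1W; rewrite !inE => /andP[_ /orP[/eqP//|x1W]].
  by move: (proj1 (sep1 W WG) x1W) => /subsetP/(_ b (setU11 _ _)); rewrite (negPf bW).
have y1a : y1 = a.
  move: y1W; rewrite !inE negb_or => /andP[/andP[y1b y1W] /or4P[/eqP//|/eqP e|/eqP e|e]].
  - by rewrite e eqxx in y1b.
  - by move: lt1; rewrite e x1b => /(ltn_trans bc); rewrite ltnn.
  - by rewrite e in y1W.
have aB : a \in B.
  by rewrite -y1a; apply/negPn/negP => /(proj2 (sep1 B (setU11 _ _))); apply/negP.
have xWb : x \notin Wb by apply: contra nBsub; apply: (proj1 (sep Wb WbG)).
move: xB yB xWb; rewrite !inE negb_or => /andP[_ xB] /andP[yB yY] /andP[xb xW].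
have bB : b \in B by apply: (subsetP WbB); apply: setU11.
have := subsetP BY x xB; rewrite !inE (negPf xb) (negPf xW) orbF /=.
case/or4P: yY => [/eqP ey|/eqP ey|/eqP ey|yW].
- by rewrite ey aB in yB.
- by rewrite ey bB in yB.
- case/orP => /eqP ex; move: lt; rewrite ex ey ?ltnn //.
  by move=> /(ltn_trans ac); rewrite ltnn.
- by rewrite (subsetP WB) in yB.
Qed.

(** A boundary vanishes at a facet, because a facet lies in no larger face. *)
Lemma facet_detects (V : finType) (K : {set {set V}}) (i : int)
    (z : {set V} -> int) (F : {set V}) :
  (forall G, full_bd z G = 0) ->
  (forall G, z G != 0 -> G \in K /\ #|G|%:Z = i + 1) ->
  z F != 0 -> (forall v, v |: F \in K -> v \in F) ->
  exists h : reduced_homology K i, h != 0.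
Proof.
move=> zz zs zF facF; apply/homology_neq0P.
exists [ffun G : face K i => z (val G)]; split.
  apply/ffunP => G; rewrite bdE [RHS]ffunE -[RHS](zz (val G)).
  apply: eq_bigr => v _; congr (_ * _).
  case: (boolP ((v |: val G \in K) && (#|v |: val G|%:Z == i + 1))) => h.
    by rewrite -[v |: val G]/(val (Sub (v |: val G) h : face K i)) extendE ffunE.
  rewrite extend_out //; apply/esym/eqP; apply: contraNT h => /zs[-> ->].
  by rewrite eqxx.
case=> b bz; have FP : (F \in K) && (#|F|%:Z == i + 1) by have [-> ->] := zs F zF; rewrite eqxx.
case/negP: zF; apply/eqP.
have := congr1 (fun c : chain K i => c (Sub F FP)) bz; rewrite /= [in RHS]ffunE /= => <-.
rewrite ffunE big1 // => F' _.
have [->|/incidence_neq0[sub cF]] := eqVneq (incidence (val F') F) 0; first by rewrite mul0r.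
have /card_gt0P[v] : (0 < #|val F' :\: F|)%N by rewrite cardsD (setIidPr sub) cF subSnn.
rewrite inE => /andP[vF vF'].
suff : v |: F \in K by move/facF; rewrite (negPf vF).
suff -> : v |: F = val F' by have := valP F' => /andP[].
by apply/eqP; rewrite eqEcard subUset sub1set vF' sub cardsU1 vF cF add1n leqnn.
Qed.

(** * The faces of the h-complex *)

Local Open Scope nat_scope.

Lemma mem_prefix_set (n : nat) (s : 'S_n) (i z : 'I_n) :
  (z \in prefix_set s i) = (s^-1%g z <= i).
Proof.
apply/imsetP/idP => [[k]|le]; first by rewrite inE => ki ->; rewrite permK.
by exists (s^-1%g z); rewrite ?inE ?permKV.
Qed.

Lemma new_face_descent_chain (n : nat) (s : 'S_n) :
  descent_chain set0 setT (new_face s).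
Proof.
move=> B /imsetP[i]; rewrite inE => /existsP[j /andP[/eqP ji lt]] ->.
have {}ji : j = i.+1 :> nat := ji.
split; [exact: sub0set | exact: subsetT | |].
  move=> C /imsetP[k _ ->]; case: (leqP i k) => ik; [left | right];
    apply/subsetP => z; rewrite !mem_prefix_set => h; first exact: leq_trans ik.
  exact: leq_trans (ltnW ik).
exists (s i), (s j); split=> //; rewrite ?inE ?mem_prefix_set ?permK //.
  exact: leqnn.
  by rewrite ji ltnn.
move=> C /imsetP[k _ ->]; rewrite !mem_prefix_set !permK -ltnNge ji ltnS.
by split=> ik; apply/subsetP => z; rewrite !mem_prefix_set => /leq_trans; apply.
Qed.

(** The permutation lists the letters block by block, increasingly inside each
    block.  Its descents are at the ends of the blocks: if some letter of a block
    exceeds some letter of the next one, then so do the last letter of the first block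
    and the first letter of the second. *)
Lemma descent_chain_new_face (n : nat) (F : {set {set 'I_n}}) :
  descent_chain set0 setT F -> exists s : 'S_n, new_face s = F.
Proof.
move=> gF.
(* [blk x] is the index of the block of [x]; letters are listed by the pair
   (block, letter), which [key] encodes in base [n]. *)
pose blk (x : 'I_n) := #|[set B in F | x \notin B]|.
pose key (x : 'I_n) := blk x * n + x.
pose before (x : 'I_n) := [set y : 'I_n | key y < key x].
have blk_key x y : blk x < blk y -> key x < key y.
  move=> h; apply: (@leq_trans ((blk x).+1 * n)).
    by rewrite /key mulSn [n + _]addnC ltn_add2l.
  by apply: leq_trans (leq_addr _ _); rewrite leq_mul2r h orbT.
have key_inj : injective key.
  move=> x y e; case: (ltngtP (blk x) (blk y)) => [/blk_key|/blk_key|eb].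
  - by rewrite e ltnn.
  - by rewrite e ltnn.
  - by apply/val_inj; move: e; rewrite /key eb => /addnI.
have before_lt x y : (#|before x| < #|before y|) = (key x < key y).
  case: (ltnP (key x) (key y)) => h.
    apply/proper_card/properP; split.
      by apply/subsetP => w; rewrite !inE => /ltn_trans; apply.
    by exists x; rewrite inE ?ltnn.
  apply/negbTE; rewrite -leqNgt; apply/subset_leq_card/subsetP => w.
  by rewrite !inE => /leq_trans; apply.
have pos_lt x : #|before x| < n.
  rewrite -[X in _ < X]card_ord -cardsT; apply/proper_card/properP.
  by split; [exact: subsetT | exists x; rewrite ?inE ?ltnn].
pose pos x := Ordinal (pos_lt x).
have pos_inj : injective pos.
  move=> x y exy; have e : #|before x| = #|before y| := congr1 val exy.
  by apply: key_inj; apply/eqP; rewrite eqn_leq leqNgt -before_lt e ltnn leqNgt -before_lt e ltnn.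
pose t := perm pos_inj; exists (t^-1)%g.
have tE x : (t^-1)^-1%g x = #|before x| :> nat by rewrite invgK permE.
have posK i : #|before ((t^-1)%g i)| = i.
  by have := congr1 val (permKV t i); rewrite [t _]permE.
have sep_blk B z w : B \in F -> z \in B -> w \notin B -> key z < key w.
  move=> BF zB wB; apply/blk_key/proper_card/properP; split.
    apply/subsetP => C; rewrite !inE => /andP[CF zC]; rewrite CF /=.
    have [_ _ cB _] := gF B BF; case: (cB C CF) => [/subsetP/(_ z zB)|/subsetP CB].
      by rewrite (negPf zC).
    by apply: contra wB; apply: CB.
  by exists B; rewrite !inE BF ?wB ?zB.
have posB B z : B \in F -> (z \in B) = (#|before z| < #|B|).
  move=> BF; case: (boolP (z \in B)) => zB.
    apply/esym/proper_card/properP; split; last by exists z; rewrite ?inE ?ltnn.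
    apply/subsetP => w; rewrite inE => wz; apply/negPn/negP => wB.
    by move: (ltn_trans wz (sep_blk B z w BF zB wB)); rewrite ltnn.
  apply/esym/negbTE; rewrite -leqNgt; apply/subset_leq_card/subsetP => w wB.
  by rewrite inE; apply: sep_blk wB zB.
apply/setP => B; apply/imsetP/idP => [[i]|BF].
  rewrite inE => /existsP[j /andP[/eqP ji lt]] ->; have {}ji : j = i.+1 :> nat := ji.
have {}ji : j = i.+1 :> nat := ji.
  set x := (t^-1)%g i in lt; set y := (t^-1)%g j in lt.
  have px : #|before x| = i by apply: posK.
  have py : #|before y| = j by apply: posK.
  have kxy : key x < key y.
    by rewrite -before_lt px py ji.
  have [C CF /andP[yC xC]] : exists2 C, C \in F & (y \notin C) && (x \in C).
    apply/exists_inP; apply: contraTT kxy; rewrite negb_exists_in => /forall_inP none.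
    rewrite -leqNgt /key leq_add ?leq_mul2r //; last exact: ltnW.
    apply/orP; right; apply/subset_leq_card/subsetP => C; rewrite !inE => /andP[CF yC].
    by rewrite CF /=; have := none C CF; rewrite yC.
  suff -> : prefix_set (t^-1)%g i = C by [].
  apply/setP => z; rewrite mem_prefix_set tE (posB C z CF).
  have := posB C x CF; rewrite xC px => /esym iC.
  have := posB C y CF; rewrite (negPf yC) py ji => /esym/negbT; rewrite -leqNgt => Ci.
  by have -> : #|C| = i.+1 by apply/eqP; rewrite eqn_leq Ci.
have [_ _ _ [x0 [y0 [x0B y0B lt sep]]]] := gF B BF.
move: x0B y0B; rewrite !inE /= andbT => x0B y0B.
have B0 : 0 < #|B| by apply/card_gt0P; exists x0.
have Bn : #|B| < n.
  rewrite -[X in _ < X]card_ord -cardsT; apply/proper_card/properP.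
  by split; [exact: subsetT | exists y0; rewrite ?inE].
have Bn' : #|B|.-1 < n by apply: leq_ltn_trans Bn; apply: leq_pred.
pose i := Ordinal Bn'; pose j := Ordinal Bn.
exists i; last first.
  by apply/setP => z; rewrite mem_prefix_set tE (posB B z BF) /= -[in LHS](prednK B0) ltnS.
rewrite inE; apply/existsP; exists j; rewrite /= prednK // eqxx /=.
set x := (t^-1)%g i; set y := (t^-1)%g j.
have px : #|before x| = i by apply: posK.
have py : #|before y| = j by apply: posK.
have xB : x \in B by rewrite (posB B x BF) px /= prednK.
have yB : y \notin B by rewrite (posB B y BF) py /= ltnn.
have bx : blk x <= blk x0.
  apply/subset_leq_card/subsetP => C; rewrite !inE => /andP[CF xC]; rewrite CF /=.
  by apply: contra xC => /(proj1 (sep C CF))/subsetP; apply.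
have by0 : blk y0 <= blk y.
  apply/subset_leq_card/subsetP => C; rewrite !inE => /andP[CF y0C]; rewrite CF /=.
  by apply: contra yB; apply: (subsetP (proj2 (sep C CF) y0C)).
have kx : key x0 <= key x.
  rewrite leqNgt -before_lt px /= -leqNgt.
  by rewrite -ltnS prednK // -(posB B x0 BF).
have ky : key y <= key y0.
  rewrite leqNgt -before_lt py /= -leqNgt.
  by rewrite leqNgt -(posB B y0 BF).
have xx : x0 <= x.
  by move: (leq_trans kx (leq_add (leq_mul bx (leqnn n)) (leqnn x))); rewrite leq_add2l.
have yy : y <= y0.
  by move: (leq_trans (leq_add (leq_mul by0 (leqnn n)) (leqnn y)) ky); rewrite leq_add2l.
exact: leq_ltn_trans yy (leq_trans lt xx).
Qed.

Lemma mem_h_complex (n : nat) (F : {set {set 'I_n}}) :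
  F \in h_complex n <-> descent_chain set0 setT F.
Proof.
split=> [/imsetP[s _ ->]|/descent_chain_new_face[s <-]]; first exact: new_face_descent_chain.
exact: imset_f.
Qed.

Lemma h_complex_down_closed (n : nat) : down_closed (h_complex n).
Proof.
by move=> F G /mem_h_complex gF GF; apply/mem_h_complex; apply: descent_chain_sub gF.
Qed.

(** * Cycles in the whole range *)

Lemma set_max (n : nat) (W : {set 'I_n}) : W != set0 ->
  exists2 m, m \in W & forall w, w \in W :\ m -> w < m.
Proof.
case/set0Pn => m0 m0W.
case: (@arg_maxnP _ m0 (mem W) (@nat_of_ord n) m0W) => m mW mmax; exists m => // w.
by rewrite !inE => /andP[wm wW]; rewrite ltn_neqAle wm /=; apply: mmax.
Qed.

Lemma set_min (n : nat) (W : {set 'I_n}) : W != set0 ->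
  exists2 m, m \in W & forall w, w \in W :\ m -> m < w.
Proof.
case/set0Pn => m0 m0W.
case: (@arg_minnP _ m0 (mem W) (@nat_of_ord n) m0W) => m mW mmin; exists m => // w.
by rewrite !inE => /andP[wm wW]; rewrite ltn_neqAle eq_sym wm /=; apply: mmin.
Qed.

(** Three largest letters are removed when [#|W| = 3 * d + 1], three smallest ones
    when [2 * #|W| = 3 * d + 2], and the smallest and the largest one between these two
    extremes; each choice stays in the range. *)
Lemma detected_cycle_exists (n : nat) (W : {set 'I_n}) (d : nat) :
  #|W| <= 3 * d + 1 -> 3 * d + 2 <= 2 * #|W| -> detected_cycle W d.
Proof.
have [s] := ubnP #|W|; elim: s W d => // s IH W d le_s h1 h2.
have pos (A : {set 'I_n}) : 0 < #|A| -> A != set0 by rewrite card_gt0.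
have del (A : {set 'I_n}) x : x \in A -> #|A :\ x| = #|A|.-1.
  by move=> xA; rewrite (cardsD1 x A) xA.
have [le1|gt1] := leqP #|W| 1.
  have /cards1P[w ->] : #|W| == 1 by clear -h2 le1; lia.
  have -> : d = 0 by clear -h2 le1; lia.
  exact: detected_point.
have [hA|hA] := boolP ((#|W| <= 3 * d) && (3 * d + 3 <= 2 * #|W|)).
  have [b bW bmax] := set_max (pos W (ltnW gt1)).
  have c1 := del W b bW.
  have [a aW amin] : exists2 a, a \in W :\ b & forall w, w \in W :\ b :\ a -> a < w.
    by apply/set_min/pos; rewrite c1; clear -gt1; lia.
  have c2 := del _ a aW.
  have d0 : d = d.-1.+1 by clear -hA gt1; lia.
  rewrite d0 -(setD1K bW) -(setD1K aW) setUCA; apply: detected_outer.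
  - by apply: pos; rewrite c2 c1; clear -hA gt1; lia.
  - move=> w wW; split; first exact: amin.
    by apply: bmax; move: wW; rewrite !inE => /and3P[_ -> ->].
  - exact: bmax.
  - by apply: IH; rewrite c2 c1; clear -hA gt1 le_s; lia.
have [eB|nB] := eqVneq #|W| (3 * d + 1).
  have [c cW cmax] := set_max (pos W (ltnW gt1)).
  have c1 := del W c cW.
  have [b bW bmax] : exists2 b, b \in W :\ c & forall w, w \in W :\ c :\ b -> w < b.
    by apply/set_max/pos; rewrite c1; clear -gt1; lia.
  have c2 := del _ b bW.
  have [a aW amax] : exists2 a, a \in W :\ c :\ b &
      forall w, w \in W :\ c :\ b :\ a -> w < a.
    by apply/set_max/pos; rewrite c2 c1; clear -gt1 eB; lia.
  have c3 := del _ a aW.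
  have d0 : d = d.-1.+1 by clear -eB gt1; lia.
  rewrite d0 -(setD1K cW) -(setD1K bW) -(setD1K aW).
  rewrite [b |: (a |: _)]setUCA [c |: (a |: _)]setUCA [c |: (b |: _)]setUCA.
  apply: detected_upper => //.
  - by apply: pos; rewrite c3 c2 c1; clear -eB gt1; lia.
  - exact: bmax.
  - exact: cmax.
  - by apply: IH; rewrite c3 c2 c1; clear -eB gt1 le_s; lia.
have eC : 2 * #|W| = 3 * d + 2 by clear -hA nB h1 h2; lia.
have [a aW amin] := set_min (pos W (ltnW gt1)).
have c1 := del W a aW.
have [b bW bmin] : exists2 b, b \in W :\ a & forall w, w \in W :\ a :\ b -> b < w.
  by apply/set_min/pos; rewrite c1; clear -gt1; lia.
have c2 := del _ b bW.
have [c cW cmin] : exists2 c, c \in W :\ a :\ b &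
    forall w, w \in W :\ a :\ b :\ c -> c < w.
  by apply/set_min/pos; rewrite c2 c1; clear -gt1 eC; lia.
have c3 := del _ c cW.
have d0 : d = d.-2.+2 by clear -eC gt1; lia.
rewrite d0 -(setD1K aW) -(setD1K bW) -(setD1K cW); apply: detected_lower => //.
- by apply: pos; rewrite c3 c2 c1; clear -eC gt1; lia.
- exact: amin.
- exact: bmin.
- by apply: IH; rewrite c3 c2 c1; clear -eC gt1 le_s; lia.
Qed.

Local Open Scope ring_scope.

Theorem mainTheorem1 (n : nat) (hn : (1 <= n)%N) (i : int) :
  (exists h : reduced_homology (h_complex n) i, h != 0) <->
  ((3 * i + 5)%:~R / 2 <= n%:R :> rat) /\ (n%:Z <= 3 * i + 4).
Proof.
have -> : ((3 * i + 5)%:~R / 2 <= n%:R :> rat) = (3 * i + 5 <= 2 * n%:Z).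
  rewrite ler_pdivrMr // -[n%:R * 2]/((n%:Z)%:~R * (2%:Z)%:~R : rat) -intrM ler_int.
  by rewrite [n%:Z * _]mulrC.
split=> [/homology_neq0P[c [zc nb]]|[h1 h2]].
  have [[d [di]]|none] := pselect (exists d : nat, d%:Z = i + 1 /\ homology_range n d).
    by rewrite /homology_range; lia.
  case: nb; apply: (@morse_exact _ _ (homology_range n)) => //.
  - exact: h_complex_down_closed.
  - have := @morse_descent_chain n set0 setT (sub0set _); rewrite cardsT card_ord cards0 subn0.
    by apply: morse_weaken => // F; split=> /mem_h_complex.
  - by move=> d di rd; apply: none; exists d.
pose d := absz (i + 1).
have di : d%:Z = i + 1 by rewrite /d; lia.
have [||z [F [zz zs zF facF]]] := @detected_cycle_exists n setT d; rewrite ?cardsT ?card_ord; try lia.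
apply: (@facet_detects _ _ _ z F) => // [G /zs[gG cG]|B /mem_h_complex/facF//].
by split; [apply/mem_h_complex | rewrite cG].
Qed.
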